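(* Let $q$ be a real constant with $0<|q/2|<1$ and let $s,\ell\in\mathbb R$, $s\neq\ell$. Put $\Delta_\pm=\sqrt{1+(q/2)^2\lambda^{\pm2}}$ and $$A_\pm=\frac1{\Delta_\pm}\begin{pmatrix}1&\pm\frac i2q\lambda^{\pm1}\\ \pm\frac i2q\lambda^{\pm1}&1\end{pmatrix},\qquad F_+(n)=\mathrm{diag}(e^{is},e^{-is})A_+^n,\quad G_-(m)=\mathrm{diag}(e^{i\ell},e^{-i\ell})A_-^m\quad(n,m\ge0,\ A_\pm^0=\mathrm{Id}).$$ Decompose $F_+(n)^{-1}G_-(m)=V_-V_+^{-1}$ with $V_-\in\Lambda^-_*\mathrm{SU}_2$, $V_+\in\Lambda^+\mathrm{SU}_2$, and set $F=F_+V_-=G_-V_+$. Then $$\lambda F^{-1}\partial_\lambda F=\frac{1}{\Delta_+^2\Delta_-^2}\begin{pmatrix}a&b\lambda^{-1}+c\lambda\\ -\bar b\lambda^{-1}-\bar c\lambda&-a\end{pmatrix},$$ where $a\in i\mathbb R$ and $b,c\in\mathbb C$ are functions of $(n,m)$ only (independent of $\lambda$).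
   Context: Pauli matrix $\sigma_3=\mathrm{diag}(1,-1)$. Loop groups: $\Lambda\mathrm{SU}_2$ is the group of maps $g$ of the spectral parameter $\lambda$ into $\mathrm{SL}_2\mathbb C$ with Wiener-algebra entries, satisfying $g(\lambda)=\big(\overline{g(\bar\lambda)}^{\,t}\big)^{-1}$ and $\sigma_3g(\lambda)\sigma_3^{-1}=g(-\lambda)$. $\Lambda^+\mathrm{SU}_2$ (resp. $\Lambda^-\mathrm{SU}_2$) consists of loops extending holomorphically to the open unit disk (resp. to $\{|\lambda|>1\}\cup\{\infty\}$); $\Lambda^-_*\mathrm{SU}_2=\{g\in\Lambda^-\mathrm{SU}_2:g(\infty)=\mathrm{Id}\}$. Birkhoff decomposition (known fact): every $g\in\Lambda\mathrm{SU}_2$ factors uniquely as $g=g_-g_+$ with $g_-\in\Lambda^-_*\mathrm{SU}_2$, $g_+\in\Lambda^+\mathrm{SU}_2$. The branches of $\Delta_\pm$ are positive for $\lambda>0$. *)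

(* Defs.v *)
From Stdlib Require Import Reals ZArith.
Open Scope R_scope.

Record Cplx := mkC { Re : R ; Im : R }.

Definition RtoC (x : R) : Cplx := mkC x 0.
Definition C0 : Cplx := RtoC 0.
Definition C1 : Cplx := RtoC 1.
Definition Ci : Cplx := mkC 0 1.
Definition Cadd (z w : Cplx) : Cplx := mkC (Re z + Re w) (Im z + Im w).
Definition Copp (z : Cplx) : Cplx := mkC (- Re z) (- Im z).
Definition Csub (z w : Cplx) : Cplx := Cadd z (Copp w).
Definition Cmul (z w : Cplx) : Cplx :=
  mkC (Re z * Re w - Im z * Im w) (Re z * Im w + Im z * Re w).
Definition Cconj (z : Cplx) : Cplx := mkC (Re z) (- Im z).
Definition Cnorm (z : Cplx) : R := sqrt (Re z * Re z + Im z * Im z).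
Definition Cinv (z : Cplx) : Cplx :=
  let r := Re z * Re z + Im z * Im z in mkC (Re z / r) (- Im z / r).
Definition Cdiv (z w : Cplx) : Cplx := Cmul z (Cinv w).
Definition Cexpi (t : R) : Cplx := mkC (cos t) (sin t).
Fixpoint Cpow (z : Cplx) (n : nat) : Cplx :=
  match n with O => C1 | S k => Cmul z (Cpow z k) end.
(* principal square root: the branch with nonnegative real part
   (positive on the positive real axis); cut along the negative reals *)
Definition Csqrt (z : Cplx) : Cplx :=
  let r := Cnorm z in
  mkC (sqrt ((r + Re z) / 2))
      ((if Rle_dec 0 (Im z) then 1 else -1) * sqrt ((r - Re z) / 2)).

Definition on_circle (z : Cplx) : Prop := Cnorm z = 1.

Record M2 := mkM2 { m11 : Cplx ; m12 : Cplx ; m21 : Cplx ; m22 : Cplx }.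

Definition Mid : M2 := mkM2 C1 C0 C0 C1.
Definition Mmul (A B : M2) : M2 :=
  mkM2 (Cadd (Cmul (m11 A) (m11 B)) (Cmul (m12 A) (m21 B)))
       (Cadd (Cmul (m11 A) (m12 B)) (Cmul (m12 A) (m22 B)))
       (Cadd (Cmul (m21 A) (m11 B)) (Cmul (m22 A) (m21 B)))
       (Cadd (Cmul (m21 A) (m12 B)) (Cmul (m22 A) (m22 B))).
Definition Madd (A B : M2) : M2 :=
  mkM2 (Cadd (m11 A) (m11 B)) (Cadd (m12 A) (m12 B))
       (Cadd (m21 A) (m21 B)) (Cadd (m22 A) (m22 B)).
Definition Mscale (c : Cplx) (A : M2) : M2 :=
  mkM2 (Cmul c (m11 A)) (Cmul c (m12 A)) (Cmul c (m21 A)) (Cmul c (m22 A)).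
Definition Msub (A B : M2) : M2 := Madd A (Mscale (RtoC (-1)) B).
Definition Mdet (A : M2) : Cplx :=
  Csub (Cmul (m11 A) (m22 A)) (Cmul (m12 A) (m21 A)).
(* inverse via the adjugate (the true inverse whenever det A <> 0) *)
Definition Minv (A : M2) : M2 :=
  Mscale (Cinv (Mdet A)) (mkM2 (m22 A) (Copp (m12 A)) (Copp (m21 A)) (m11 A)).
Definition Mconjt (A : M2) : M2 :=
  mkM2 (Cconj (m11 A)) (Cconj (m21 A)) (Cconj (m12 A)) (Cconj (m22 A)).
Fixpoint Mpow (A : M2) (n : nat) : M2 :=
  match n with O => Mid | S k => Mmul A (Mpow A k) end.
Definition Mdiag (x y : Cplx) : M2 := mkM2 x C0 C0 y.
Definition sigma3 : M2 := Mdiag C1 (RtoC (-1)).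
Definition Mnorm (A : M2) : R :=
  Cnorm (m11 A) + Cnorm (m12 A) + Cnorm (m21 A) + Cnorm (m22 A).

Definition Cseries_cv (u : nat -> Cplx) (l : Cplx) : Prop :=
  infinite_sum (fun k => Re (u k)) (Re l) /\ infinite_sum (fun k => Im (u k)) (Im l).

(* f restricted to the unit circle is the absolutely convergent Fourier/Laurent
   series  sum_{k in Z} c k lambda^k  *)
Definition wiener_repr (f : Cplx -> Cplx) (c : Z -> Cplx) : Prop :=
  (exists Ssum : R, infinite_sum
      (fun k => Cnorm (c (Z.of_nat k)) + Cnorm (c (- Z.of_nat (S k))%Z)) Ssum) /\
  forall lam : Cplx, on_circle lam ->
    exists lp lm : Cplx,
      Cseries_cv (fun k => Cmul (c (Z.of_nat k)) (Cpow lam k)) lp /\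
      Cseries_cv (fun k => Cmul (c (- Z.of_nat (S k))%Z) (Cpow (Cinv lam) (S k))) lm /\
      f lam = Cadd lp lm.

Definition Mwiener_repr (g : Cplx -> M2) (cM : Z -> M2) : Prop :=
  wiener_repr (fun l => m11 (g l)) (fun k => m11 (cM k)) /\
  wiener_repr (fun l => m12 (g l)) (fun k => m12 (cM k)) /\
  wiener_repr (fun l => m21 (g l)) (fun k => m21 (cM k)) /\
  wiener_repr (fun l => m22 (g l)) (fun k => m22 (cM k)).

(* Lambda SU_2: Wiener entries, values in SL_2(Cplx), reality and twisting conditions
   (loops are functions of lambda; only their values on the unit circle matter) *)
Definition LoopSU2 (g : Cplx -> M2) : Prop :=
  (exists cM, Mwiener_repr g cM) /\
  forall lam : Cplx, on_circle lam ->
    Mdet (g lam) = C1 /\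
    g lam = Minv (Mconjt (g (Cconj lam))) /\
    Mmul (Mmul sigma3 (g lam)) (Minv sigma3) = g (Copp lam).

(* Lambda^+ SU_2: holomorphic extension to the open unit disk,
   i.e. all negative Fourier coefficients vanish *)
Definition LoopSU2_plus (g : Cplx -> M2) : Prop :=
  LoopSU2 g /\
  exists cM, Mwiener_repr g cM /\ forall k : Z, (k < 0)%Z -> cM k = mkM2 C0 C0 C0 C0.

(* Lambda^-_* SU_2: holomorphic extension to {|lambda|>1} u {oo}, i.e. all positive
   Fourier coefficients vanish, and g(oo) (= 0-th coefficient) = Id *)
Definition LoopSU2_minus_star (g : Cplx -> M2) : Prop :=
  LoopSU2 g /\
  exists cM, Mwiener_repr g cM /\ (forall k : Z, (0 < k)%Z -> cM k = mkM2 C0 C0 C0 C0)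
             /\ cM 0%Z = Mid.

Definition circle_deriv (F : Cplx -> M2) (lam : Cplx) (D : M2) : Prop :=
  forall eps : R, 0 < eps -> exists delta : R, 0 < delta /\
    forall mu : Cplx, on_circle mu -> mu <> lam -> Cnorm (Csub mu lam) < delta ->
      Mnorm (Msub (Mscale (Cinv (Csub mu lam)) (Msub (F mu) (F lam))) D) < eps.

Definition half_q (q : R) : Cplx := RtoC (q / 2).

Definition Delta_plus (q : R) (lam : Cplx) : Cplx :=
  Csqrt (Cadd C1 (Cmul (Cmul (half_q q) (half_q q)) (Cmul lam lam))).
Definition Delta_minus (q : R) (lam : Cplx) : Cplx :=
  Csqrt (Cadd C1 (Cmul (Cmul (half_q q) (half_q q)) (Cmul (Cinv lam) (Cinv lam)))).

Definition A_plus (q : R) (lam : Cplx) : M2 :=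
  let x := Cmul Ci (Cmul (half_q q) lam) in
  Mscale (Cinv (Delta_plus q lam)) (mkM2 C1 x x C1).
Definition A_minus (q : R) (lam : Cplx) : M2 :=
  let x := Copp (Cmul Ci (Cmul (half_q q) (Cinv lam))) in
  Mscale (Cinv (Delta_minus q lam)) (mkM2 C1 x x C1).

Definition F_plus (q s : R) (n : nat) (lam : Cplx) : M2 :=
  Mmul (Mdiag (Cexpi s) (Cexpi (- s))) (Mpow (A_plus q lam) n).
Definition G_minus (q l : R) (m : nat) (lam : Cplx) : M2 :=
  Mmul (Mdiag (Cexpi l) (Cexpi (- l))) (Mpow (A_minus q lam) m).

(* Main.v *)
(* Write x for lambda and X = x F^-1 dF/dx. On the circle F = F_+ V_- = G_- V_+, and the only
   non-polynomial ingredients of F_+ and G_- are the scalars Delta_+ and Delta_-. Hence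
   Delta_+^n V_+ has only frequencies >= 0, while being also x^n times a loop with frequencies
   <= 0: it is a polynomial in x. So V_+ is differentiable, and computing X from G_- V_+ shows that
   Delta_+^2 Delta_-^2 X has only frequencies >= -1. The substitution x -> 1/x, q -> -q exchanges
   the two factorizations and gives frequencies <= 1. The form of the three remaining
   coefficients follows from det F = 1, the twisting and the reality condition. *)
Require Import Defs.
From Stdlib Require Import Reals ZArith Lra Lia Psatz List.
Import ListNotations Defs.
Open Scope R_scope.

(** * Complex numbers and polynomials *)

(** The loops [Vm] and [Vp] are only Wiener, so no derivative of [F] is given in advance:
    differentiability has to come out of the polynomial identity. Fourier coefficients are handled
    without integrals. [Pp] describes nonnegative frequencies through l^1 limits of polynomials, and
    averages over roots of unity isolate single coefficients of the approximants. Derivatives are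
    values of [lambda d/dlambda] along the circle, the only set on which loops matter; this operator
    transforms simply under [x -> 1/x], [x -> -x] and [x -> conj x]. The bound [|q/2| < 1] keeps
    [Delta_plus^2] off the branch cut and makes the iterations for [Delta_plus] and
    [1 / Delta_plus^2] contract in l^1 norm with ratio [(q/2)^2]. With [Q = q/2], the frequency [-1]
    has two sources after multiplication by [Delta_plus^2 Delta_minus^2]: the derivative of
    [A_minus ^ m] carries [1/x], and the derivative of [V_+], which carries a factor [x], meets
    [Delta_minus^2 = 1 + Q^2/x^2]. *)

Lemma Cplx_eq (z w : Cplx) : Re z = Re w -> Im z = Im w -> z = w.
Proof. destruct z, w; simpl; intros -> ->; reflexivity. Qed.

Ltac cplx := intros; apply Cplx_eq; simpl; ring.

Lemma Cplx_ring_theory : ring_theory C0 C1 Cadd Cmul Csub Copp eq.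
Proof. constructor; try cplx; reflexivity. Qed.

Lemma sum_sqr_neq_0 (z : Cplx) : z <> C0 -> Re z * Re z + Im z * Im z <> 0.
Proof.
  intros Hz H; apply Hz, Cplx_eq; simpl; nra.
Qed.

Lemma Cinv_l (z : Cplx) : z <> C0 -> Cmul (Cinv z) z = C1.
Proof.
  intros Hz; pose proof (sum_sqr_neq_0 z Hz).
  apply Cplx_eq; simpl; field; assumption.
Qed.

Lemma Cplx_field_theory : field_theory C0 C1 Cadd Cmul Csub Copp Cdiv Cinv eq.
Proof.
  constructor.
  - exact Cplx_ring_theory.
  - intros H; apply (f_equal Re) in H; simpl in H; lra.
  - reflexivity.
  - exact Cinv_l.
Qed.

Add Field Cplx_field : Cplx_field_theory.

Declare Scope cplx_scope.
Delimit Scope cplx_scope with C.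
Bind Scope cplx_scope with Cplx.
Infix "+" := Cadd : cplx_scope.
Infix "*" := Cmul : cplx_scope.
Infix "-" := Csub : cplx_scope.
Notation "- z" := (Copp z) : cplx_scope.
Notation "/ z" := (Cinv z) : cplx_scope.
Notation "1" := C1 : cplx_scope.
Notation "0" := C0 : cplx_scope.

Lemma Cplx_eq_dec (z w : Cplx) : {z = w} + {z <> w}.
Proof.
  destruct (Req_EM_T (Re z) (Re w)) as [H|H].
  - destruct (Req_EM_T (Im z) (Im w)) as [H'|H'].
    + left; apply Cplx_eq; assumption.
    + right; intros ->; auto.
  - right; intros ->; auto.
Qed.

Lemma C1_neq_0 : 1%C <> 0%C.
Proof. intros H; apply (f_equal Re) in H; simpl in H; lra. Qed.

Lemma Cmul_neq_0 (z w : Cplx) : z <> 0%C -> w <> 0%C -> (z * w)%C <> 0%C.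
Proof.
  intros Hz Hw H; apply Hw.
  replace w with (/ z * (z * w))%C by (field; assumption).
  rewrite H; ring.
Qed.

Lemma Ci_sqr : (Ci * Ci)%C = (- (1))%C.
Proof. cplx. Qed.

Lemma Cnorm_ge_0 (z : Cplx) : 0 <= Cnorm z.
Proof. apply sqrt_pos. Qed.

Lemma Cnorm_sqr (z : Cplx) : Cnorm z * Cnorm z = Re z * Re z + Im z * Im z.
Proof. apply sqrt_sqrt; nra. Qed.

Lemma Cnorm_unique (z : Cplx) (r : R) :
  0 <= r -> r * r = Re z * Re z + Im z * Im z -> Cnorm z = r.
Proof. intros Hr H; unfold Cnorm; rewrite <- H; apply sqrt_square, Hr. Qed.

Lemma Cnorm_mul (z w : Cplx) : Cnorm (z * w) = Cnorm z * Cnorm w.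
Proof.
  apply Cnorm_unique.
  - apply Rmult_le_pos; apply Cnorm_ge_0.
  - transitivity ((Cnorm z * Cnorm z) * (Cnorm w * Cnorm w)); [ring|].
    rewrite !Cnorm_sqr; simpl; ring.
Qed.

Lemma Cnorm_add (z w : Cplx) : Cnorm (z + w) <= Cnorm z + Cnorm w.
Proof.
  pose proof (Cnorm_ge_0 z); pose proof (Cnorm_ge_0 w).
  pose proof (Cnorm_sqr z) as Hz; pose proof (Cnorm_sqr w) as Hw.
  apply Rsqr_incr_0_var; [|lra].
  unfold Rsqr; rewrite Cnorm_sqr; simpl.
  assert (Re z * Re w + Im z * Im w <= Cnorm z * Cnorm w); [|nra].
  apply Rsqr_incr_0_var; [|nra].
  unfold Rsqr.
  replace (Cnorm z * Cnorm w * (Cnorm z * Cnorm w)) with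
    ((Cnorm z * Cnorm z) * (Cnorm w * Cnorm w)) by ring.
  rewrite Hz, Hw; pose proof (Rle_0_sqr (Re z * Im w - Im z * Re w)) as H1.
  unfold Rsqr in H1; nra.
Qed.

Lemma Cnorm_opp (z : Cplx) : Cnorm (- z) = Cnorm z.
Proof. unfold Cnorm; f_equal; simpl; ring. Qed.

Lemma Cnorm_conj (z : Cplx) : Cnorm (Cconj z) = Cnorm z.
Proof. unfold Cnorm; f_equal; simpl; ring. Qed.

Lemma Cnorm_sub_sym (z w : Cplx) : Cnorm (z - w) = Cnorm (w - z).
Proof. rewrite <- Cnorm_opp; f_equal; ring. Qed.

Lemma Cnorm_0 : Cnorm 0 = 0.
Proof. apply Cnorm_unique; simpl; lra. Qed.

Lemma Cnorm_1 : Cnorm 1 = 1.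
Proof. apply Cnorm_unique; simpl; lra. Qed.

Lemma Cnorm_RtoC (x : R) : Cnorm (RtoC x) = Rabs x.
Proof.
  apply Cnorm_unique; [apply Rabs_pos|].
  simpl; rewrite <- Rabs_mult, Rabs_right; nra.
Qed.

Lemma Cnorm_eq_0 (z : Cplx) : Cnorm z = 0 -> z = 0%C.
Proof.
  intros H; pose proof (Cnorm_sqr z) as H1; rewrite H in H1.
  apply Cplx_eq; simpl; nra.
Qed.

Lemma Cnorm_pos (z : Cplx) : z <> 0%C -> 0 < Cnorm z.
Proof.
  intros Hz; destruct (Cnorm_ge_0 z) as [H|H]; [exact H|].
  exfalso; apply Hz, Cnorm_eq_0; auto.
Qed.

Lemma Cnorm_sub (z w : Cplx) : Cnorm (z - w) <= Cnorm z + Cnorm w.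
Proof. unfold Csub; rewrite <- (Cnorm_opp w); apply Cnorm_add. Qed.

Lemma Cnorm_triangle (z u w : Cplx) : Cnorm (z - w) <= Cnorm (z - u) + Cnorm (u - w).
Proof. replace (z - w)%C with ((z - u) + (u - w))%C by ring; apply Cnorm_add. Qed.

Lemma Re_le_Cnorm (z : Cplx) : Rabs (Re z) <= Cnorm z.
Proof.
  apply Rsqr_incr_0_var; [|apply Cnorm_ge_0].
  rewrite <- Rsqr_abs; unfold Rsqr; rewrite Cnorm_sqr; nra.
Qed.

Lemma Im_le_Cnorm (z : Cplx) : Rabs (Im z) <= Cnorm z.
Proof.
  apply Rsqr_incr_0_var; [|apply Cnorm_ge_0].
  rewrite <- Rsqr_abs; unfold Rsqr; rewrite Cnorm_sqr; nra.
Qed.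

Lemma Cnorm_le_parts (z : Cplx) : Cnorm z <= Rabs (Re z) + Rabs (Im z).
Proof.
  pose proof (Rabs_pos (Re z)); pose proof (Rabs_pos (Im z)).
  apply Rsqr_incr_0_var; [|lra].
  assert (Hr : Rabs (Re z) * Rabs (Re z) = Re z * Re z)
    by (rewrite <- Rabs_mult; apply Rabs_right; nra).
  assert (Hi : Rabs (Im z) * Rabs (Im z) = Im z * Im z)
    by (rewrite <- Rabs_mult; apply Rabs_right; nra).
  unfold Rsqr; rewrite Cnorm_sqr; nra.
Qed.

Lemma Cnorm_inv (z : Cplx) : z <> 0%C -> Cnorm (/ z) = / Cnorm z.
Proof.
  intros Hz; pose proof (Cnorm_pos z Hz).
  apply Rmult_eq_reg_r with (Cnorm z); [|lra].
  rewrite <- Cnorm_mul, Cinv_l, Cnorm_1 by assumption; field; lra.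
Qed.

Lemma eq_of_Cnorm_small (z w : Cplx) :
  (forall eps, 0 < eps -> Cnorm (z - w) <= eps) -> z = w.
Proof.
  intros H.
  assert (H0 : Cnorm (z - w) = 0).
  { apply Rle_antisym; [|apply Cnorm_ge_0].
    apply le_epsilon; intros e He; rewrite Rplus_0_l; auto. }
  apply Cnorm_eq_0 in H0.
  replace z with ((z - w) + w)%C by ring; rewrite H0; ring.
Qed.

Lemma circle_neq_0 (x : Cplx) : on_circle x -> x <> 0%C.
Proof. unfold on_circle; intros H ->; rewrite Cnorm_0 in H; lra. Qed.

Lemma circle_1 : on_circle 1.
Proof. exact Cnorm_1. Qed.

Lemma circle_inv (x : Cplx) : on_circle x -> on_circle (/ x).
Proof.
  intros H; red; rewrite Cnorm_inv by (apply circle_neq_0, H).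
  rewrite H; field.
Qed.

Lemma circle_opp (x : Cplx) : on_circle x -> on_circle (- x).
Proof. unfold on_circle; rewrite Cnorm_opp; auto. Qed.

Lemma circle_conj (x : Cplx) : on_circle x -> on_circle (Cconj x).
Proof. unfold on_circle; rewrite Cnorm_conj; auto. Qed.

Lemma circle_mul (x y : Cplx) : on_circle x -> on_circle y -> on_circle (x * y).
Proof. unfold on_circle; rewrite Cnorm_mul; intros -> ->; ring. Qed.

Lemma circle_expi (t : R) : on_circle (Cexpi t).
Proof.
  apply Cnorm_unique; [lra|]; simpl.
  pose proof (sin2_cos2 t); unfold Rsqr in *; lra.
Qed.

Lemma Cinv_inv (x : Cplx) : x <> 0%C -> (/ / x)%C = x.
Proof.
  intros Hx; field; split; [exact Hx|exact C1_neq_0].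
Qed.

Lemma Cpow_add (z : Cplx) (i j : nat) : Cpow z (i + j) = (Cpow z i * Cpow z j)%C.
Proof. induction i as [|i IH]; simpl; [ring|rewrite IH; ring]. Qed.

Lemma Cpow_mul_base (z w : Cplx) (i : nat) : Cpow (z * w) i = (Cpow z i * Cpow w i)%C.
Proof. induction i as [|i IH]; simpl; [ring|rewrite IH; ring]. Qed.

Lemma Cpow_1 (i : nat) : Cpow 1 i = 1%C.
Proof.
  induction i as [|i IH]; [reflexivity|].
  change (Cpow 1 (S i)) with (1 * Cpow 1 i)%C; rewrite IH; ring.
Qed.

Lemma Cpow_inv_r (x : Cplx) (i : nat) : x <> 0%C -> (Cpow x i * Cpow (/ x) i)%C = 1%C.
Proof.
  intros Hx; rewrite <- Cpow_mul_base.
  replace (x * / x)%C with 1%C by (field; exact Hx); apply Cpow_1.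
Qed.

Lemma Cpow_neq_0 (x : Cplx) (i : nat) : x <> 0%C -> Cpow x i <> 0%C.
Proof.
  intros Hx; induction i as [|i IH]; simpl.
  - exact C1_neq_0.
  - apply Cmul_neq_0; assumption.
Qed.

Lemma Cnorm_pow_circle (x : Cplx) (i : nat) : on_circle x -> Cnorm (Cpow x i) = 1.
Proof.
  intros Hx; induction i as [|i IH]; simpl; [apply Cnorm_1|].
  rewrite Cnorm_mul, IH, Hx; ring.
Qed.

Lemma Cexpi_add (s t : R) : Cexpi (s + t) = (Cexpi s * Cexpi t)%C.
Proof. apply Cplx_eq; simpl; [apply cos_plus|rewrite sin_plus; ring]. Qed.

Lemma Cexpi_opp_r (t : R) : (Cexpi t * Cexpi (- t))%C = 1%C.
Proof.
  rewrite <- Cexpi_add, Rplus_opp_r; apply Cplx_eq; simpl; [apply cos_0|apply sin_0].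
Qed.

Lemma Cexpi_pow (t : R) (i : nat) : Cpow (Cexpi t) i = Cexpi (INR i * t).
Proof.
  induction i as [|i IH].
  - simpl; rewrite Rmult_0_l; apply Cplx_eq; simpl; [now rewrite cos_0|now rewrite sin_0].
  - simpl Cpow; rewrite IH, <- Cexpi_add, S_INR; f_equal; ring.
Qed.

(** * Polynomials as coefficient lists, with the l^1 norm *)

Definition cpoly := list Cplx.

Fixpoint peval (p : cpoly) (x : Cplx) : Cplx :=
  match p with [] => 0%C | a :: p' => (a + x * peval p' x)%C end.
(** This is the Wiener norm: submultiplicative, and an upper bound for the supremum on the unit
    circle. *)
Fixpoint pnorm (p : cpoly) : R :=
  match p with [] => 0 | a :: p' => Cnorm a + pnorm p' end.
Fixpoint padd (p r : cpoly) : cpoly :=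
  match p, r with
  | [], _ => r
  | _, [] => p
  | a :: p', b :: r' => (a + b)%C :: padd p' r'
  end.
Definition pscale (c : Cplx) (p : cpoly) : cpoly := map (Cmul c) p.
Fixpoint pmul (p r : cpoly) : cpoly :=
  match p with [] => [] | a :: p' => padd (pscale a r) (0%C :: pmul p' r) end.
(** The l^1 norm of the difference, the shorter list being padded by zeros; it does not see trailing
    zeros, whereas equality of lists would. *)
Fixpoint pdist (p r : cpoly) : R :=
  match p, r with
  | [], _ => pnorm r
  | _, [] => pnorm p
  | a :: p', b :: r' => Cnorm (a - b) + pdist p' r'
  end.

Lemma peval_padd (p r : cpoly) (x : Cplx) : peval (padd p r) x = (peval p x + peval r x)%C.
Proof.
  revert r; induction p as [|a p IH]; intros [|b r]; simpl; try rewrite IH; ring.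
Qed.

Lemma peval_pscale (c : Cplx) (p : cpoly) (x : Cplx) : peval (pscale c p) x = (c * peval p x)%C.
Proof. induction p as [|a p IH]; simpl; try fold (pscale c p); try rewrite IH; ring. Qed.

Lemma peval_pmul (p r : cpoly) (x : Cplx) : peval (pmul p r) x = (peval p x * peval r x)%C.
Proof.
  induction p as [|a p IH]; simpl; [ring|].
  rewrite peval_padd, peval_pscale; simpl; rewrite IH; ring.
Qed.

Lemma pnorm_ge_0 (p : cpoly) : 0 <= pnorm p.
Proof. induction p as [|a p IH]; simpl; [lra|pose proof (Cnorm_ge_0 a); lra]. Qed.

Lemma pdist_ge_0 (p r : cpoly) : 0 <= pdist p r.
Proof.
  revert r; induction p as [|a p IH]; intros [|b r]; simpl; try apply (pnorm_ge_0 (_ :: _)).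
  - lra.
  - pose proof (IH r); pose proof (Cnorm_ge_0 (a - b)); lra.
Qed.

Lemma pdist_nil_r (p : cpoly) : pdist p [] = pnorm p.
Proof. destruct p; reflexivity. Qed.

Lemma pdist_sym (p r : cpoly) : pdist p r = pdist r p.
Proof.
  revert r; induction p as [|a p IH]; intros [|b r]; simpl; auto.
  rewrite IH, Cnorm_sub_sym; reflexivity.
Qed.

Lemma pdist_refl (p : cpoly) : pdist p p = 0.
Proof.
  induction p as [|a p IH]; simpl; [reflexivity|].
  rewrite IH; replace (a - a)%C with 0%C by ring; rewrite Cnorm_0; ring.
Qed.

Lemma pnorm_le_pdist (p r : cpoly) : pnorm p <= pnorm r + pdist p r.
Proof.
  revert r; induction p as [|a p IH]; intros [|b r]; simpl.
  - lra.
  - pose proof (pnorm_ge_0 r); pose proof (Cnorm_ge_0 b); lra.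
  - lra.
  - pose proof (IH r); pose proof (Cnorm_add (a - b) b) as H1.
    replace (a - b + b)%C with a in H1 by ring; lra.
Qed.

Lemma pdist_triangle (p r t : cpoly) : pdist p t <= pdist p r + pdist r t.
Proof.
  revert r t; induction p as [|a p IH]; intros r t.
  - simpl; pose proof (pnorm_le_pdist t r); rewrite (pdist_sym r t); lra.
  - destruct r as [|b r], t as [|c t]; simpl.
    + lra.
    + pose proof (Cnorm_sub a c); pose proof (IH [] t); simpl in *.
      rewrite pdist_nil_r in *; lra.
    + pose proof (Cnorm_add (a - b) b) as H1.
      replace (a - b + b)%C with a in H1 by ring.
      pose proof (pnorm_le_pdist p r); lra.
    + pose proof (IH r t); pose proof (Cnorm_triangle a b c); lra.
Qed.

Lemma pdist_padd (p p' r r' : cpoly) :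
  pdist (padd p r) (padd p' r') <= pdist p p' + pdist r r'.
Proof.
  assert (Hn : forall p r, pnorm (padd p r) <= pnorm p + pnorm r).
  { clear; induction p as [|a p IH]; intros [|b r]; simpl; try lra.
    pose proof (IH r); pose proof (Cnorm_add a b); lra. }
  assert (Hl : forall p r r', pdist (padd p r) (padd p r') <= pdist r r').
  { clear; induction p as [|a p IH]; intros r r'; [simpl; lra|].
    destruct r as [|b r], r' as [|b' r']; simpl.
    - rewrite pdist_refl; replace (a - a)%C with 0%C by ring; rewrite Cnorm_0; lra.
    - replace (a - (a + b'))%C with (- b')%C by ring; rewrite Cnorm_opp.
      pose proof (IH [] r'); simpl in *.
      replace (padd p []) with p in * by (destruct p; reflexivity); lra.
    - replace (a + b - a)%C with b by ring.
      pose proof (IH r []) as H; rewrite pdist_nil_r in H.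
      replace (padd p []) with p in * by (destruct p; reflexivity); lra.
    - replace (a + b - (a + b'))%C with (b - b')%C by ring.
      pose proof (IH r r'); lra. }
  assert (Hc : forall p r, padd p r = padd r p).
  { clear; induction p as [|a p IH]; intros [|b r]; simpl; auto.
    rewrite IH; f_equal; ring. }
  pose proof (pdist_triangle (padd p r) (padd p r') (padd p' r')) as H.
  pose proof (Hl p r r'); pose proof (Hl r' p p') as H2.
  rewrite (Hc r' p), (Hc r' p') in H2; lra.
Qed.

Lemma pnorm_pscale (c : Cplx) (p : cpoly) : pnorm (pscale c p) = Cnorm c * pnorm p.
Proof.
  induction p as [|a p IH]; simpl; [ring|].
  fold (pscale c p); rewrite IH, Cnorm_mul; ring.
Qed.

Lemma pdist_pscale (c : Cplx) (p r : cpoly) :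
  pdist (pscale c p) (pscale c r) = Cnorm c * pdist p r.
Proof.
  revert r; induction p as [|a p IH]; intros [|b r]; simpl; try fold (pscale c p);
    try fold (pscale c r).
  - ring.
  - rewrite pnorm_pscale, Cnorm_mul; ring.
  - rewrite pnorm_pscale, Cnorm_mul; ring.
  - rewrite IH; replace (c * a - c * b)%C with (c * (a - b))%C by ring.
    rewrite Cnorm_mul; ring.
Qed.

Lemma pdist_pmul_l (p r r' : cpoly) : pdist (pmul p r) (pmul p r') <= pnorm p * pdist r r'.
Proof.
  induction p as [|a p IH]; simpl; [lra|].
  eapply Rle_trans; [apply pdist_padd|].
  rewrite pdist_pscale; simpl.
  replace (0 - 0)%C with 0%C by ring; rewrite Cnorm_0; lra.
Qed.

Lemma pnorm_pmul (p r : cpoly) : pnorm (pmul p r) <= pnorm p * pnorm r.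
Proof.
  assert (H0 : pnorm (pmul p []) = 0).
  { induction p as [|a p IH]; simpl; [reflexivity|]; rewrite IH, Cnorm_0; ring. }
  pose proof (pdist_pmul_l p r []) as H.
  pose proof (pnorm_le_pdist (pmul p r) (pmul p [])).
  rewrite pdist_nil_r in H; lra.
Qed.

Lemma pdist_pmul_r (p p' r : cpoly) : pdist (pmul p r) (pmul p' r) <= pdist p p' * pnorm r.
Proof.
  assert (Hs : forall a b r, pdist (pscale a r) (pscale b r) = Cnorm (a - b) * pnorm r).
  { clear; induction r as [|c r IH]; simpl; [ring|].
    fold (pscale a r) (pscale b r); rewrite IH.
    replace (a * c - b * c)%C with ((a - b) * c)%C by ring; rewrite Cnorm_mul; ring. }
  revert p'; induction p as [|a p IH]; intros [|b p'].
  - simpl; lra.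
  - exact (pnorm_pmul (b :: p') r).
  - replace (pdist (a :: p) []) with (pnorm (a :: p)) by reflexivity.
    replace (pmul [] r) with (@nil Cplx) by reflexivity.
    rewrite pdist_nil_r; exact (pnorm_pmul (a :: p) r).
  - simpl; eapply Rle_trans; [apply pdist_padd|].
    rewrite Hs; simpl; replace (0 - 0)%C with 0%C by ring; rewrite Cnorm_0.
    pose proof (IH p'); lra.
Qed.

Lemma Cnorm_peval (p : cpoly) (x : Cplx) : on_circle x -> Cnorm (peval p x) <= pnorm p.
Proof.
  intros Hx; induction p as [|a p IH]; simpl; [rewrite Cnorm_0; lra|].
  eapply Rle_trans; [apply Cnorm_add|]; rewrite Cnorm_mul, Hx; lra.
Qed.

Lemma Cnorm_peval_sub (p r : cpoly) (x : Cplx) :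
  on_circle x -> Cnorm (peval p x - peval r x) <= pdist p r.
Proof.
  intros Hx; revert r; induction p as [|a p IH]; intros [|b r].
  - simpl; replace (0 - 0)%C with 0%C by ring; rewrite Cnorm_0; lra.
  - replace (peval [] x - peval (b :: r) x)%C with (- peval (b :: r) x)%C by (simpl; ring).
    rewrite Cnorm_opp; apply Cnorm_peval, Hx.
  - replace (peval (a :: p) x - peval [] x)%C with (peval (a :: p) x)%C by (simpl; ring).
    apply Cnorm_peval, Hx.
  - simpl.
    replace (a + x * peval p x - (b + x * peval r x))%C with
      ((a - b) + x * (peval p x - peval r x))%C by ring.
    eapply Rle_trans; [apply Cnorm_add|]; rewrite Cnorm_mul, Hx.
    pose proof (IH r); lra.
Qed.

(** Makes every single coefficient of an l^1 Cauchy sequence of polynomials a Cauchy sequence of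
    complex numbers. *)
Lemma Cnorm_nth_sub (p r : cpoly) (j : nat) : Cnorm (nth j p 0%C - nth j r 0%C) <= pdist p r.
Proof.
  assert (H0 : forall (p : cpoly) j, Cnorm (nth j p 0%C) <= pnorm p).
  { clear; induction p as [|a p IH]; intros [|j]; simpl; try (rewrite Cnorm_0; lra).
    - pose proof (pnorm_ge_0 p); lra.
    - pose proof (IH j); pose proof (Cnorm_ge_0 a); lra. }
  revert r j; induction p as [|a p IH]; intros [|b r] j.
  - destruct j; simpl; replace (0 - 0)%C with 0%C by ring; rewrite Cnorm_0; lra.
  - replace (nth j [] 0%C) with 0%C by (destruct j; reflexivity).
    rewrite Cnorm_sub_sym; replace (nth j (b :: r) 0 - 0)%C with (nth j (b :: r) 0%C) by ring.
    exact (H0 (b :: r) j).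
  - replace (nth j [] 0%C) with 0%C by (destruct j; reflexivity).
    replace (nth j (a :: p) 0 - 0)%C with (nth j (a :: p) 0%C) by ring.
    exact (H0 (a :: p) j).
  - destruct j as [|j]; simpl.
    + pose proof (pdist_ge_0 p r); lra.
    + pose proof (IH r j); pose proof (Cnorm_ge_0 (a - b)); lra.
Qed.

(** * Wiener functions with nonnegative frequencies *)

(* The Wiener functions on the circle with nonnegative frequencies, as limits of polynomials in
   the l^1 norm of the coefficients; only the values of [f] on the circle matter. *)
Definition Pp (f : Cplx -> Cplx) : Prop :=
  exists p : nat -> cpoly, forall eps, 0 < eps -> exists K : nat, forall j k : nat,
    (K <= j)%nat -> (K <= k)%nat ->
    pdist (p j) (p k) <= eps /\
    forall x, on_circle x -> Cnorm (f x - peval (p k) x) <= eps.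

Lemma Pp_ext (f g : Cplx -> Cplx) :
  (forall x, on_circle x -> f x = g x) -> Pp f -> Pp g.
Proof.
  intros H [p Hp]; exists p; intros eps He.
  destruct (Hp eps He) as [K HK]; exists K; intros j k Hj Hk.
  destruct (HK j k Hj Hk) as [H1 H2]; split; [exact H1|].
  intros x Hx; rewrite <- H by exact Hx; auto.
Qed.

Lemma Pp_peval (p : cpoly) : Pp (peval p).
Proof.
  exists (fun _ => p); intros eps He; exists O; intros _ _ _ _; split.
  - rewrite pdist_refl; lra.
  - intros x _; replace (peval p x - peval p x)%C with 0%C by ring; rewrite Cnorm_0; lra.
Qed.

Lemma Pp_const (c : Cplx) : Pp (fun _ => c).
Proof. apply (Pp_ext (peval [c])); [|apply Pp_peval]; intros; simpl; ring. Qed.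

Lemma Pp_id : Pp (fun x => x).
Proof. apply (Pp_ext (peval [0%C; 1%C])); [|apply Pp_peval]; intros; simpl peval; ring. Qed.

Lemma Pp_add (f g : Cplx -> Cplx) : Pp f -> Pp g -> Pp (fun x => f x + g x)%C.
Proof.
  intros [p Hp] [r Hr]; exists (fun k => padd (p k) (r k)); intros eps He.
  destruct (Hp (eps / 2)) as [K HK]; [lra|].
  destruct (Hr (eps / 2)) as [L HL]; [lra|].
  exists (max K L); intros j k Hj Hk.
  destruct (HK j k) as [H1 H2]; [lia..|]; destruct (HL j k) as [H3 H4]; [lia..|].
  split.
  - eapply Rle_trans; [apply pdist_padd|]; lra.
  - intros x Hx; rewrite peval_padd.
    replace (f x + g x - (peval (p k) x + peval (r k) x))%C with
      ((f x - peval (p k) x) + (g x - peval (r k) x))%C by ring.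
    eapply Rle_trans; [apply Cnorm_add|]; specialize (H2 x Hx); specialize (H4 x Hx); lra.
Qed.

Lemma Pp_mul (f g : Cplx -> Cplx) : Pp f -> Pp g -> Pp (fun x => f x * g x)%C.
Proof.
  intros [p Hp] [r Hr]; exists (fun k => pmul (p k) (r k)); intros eps He.
  destruct (Hp 1) as [K1 HK1]; [lra|]; destruct (Hr 1) as [L1 HL1]; [lra|].
  (* Cauchy sequences are bounded. Of the slack [2], one unit pays for the distance of a late term
     to [p K1] or [r L1], the other for passing from [r k] to its limit [g]. *)
  set (M := pnorm (p K1) + pnorm (r L1) + 2).
  assert (HM : 2 <= M) by (pose proof (pnorm_ge_0 (p K1)); pose proof (pnorm_ge_0 (r L1));
    unfold M; lra).
  assert (He' : 0 < eps / (2 * M)) by (apply Rdiv_lt_0_compat; lra).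
  destruct (Hp _ He') as [K HK]; destruct (Hr _ He') as [L HL].
  exists (max (max K L) (max K1 L1)); intros j k Hj Hk.
  destruct (HK j k) as [H1 H2]; [lia..|]; destruct (HL j k) as [H3 H4]; [lia..|].
  destruct (HK1 j K1) as [H5 _]; [lia..|]; destruct (HL1 k L1) as [H6 H6']; [lia..|].
  destruct (HL1 k k) as [_ H7]; [lia..|]; destruct (HK1 k K1) as [H8 _]; [lia..|].
  assert (Hpj : pnorm (p j) <= M) by (pose proof (pnorm_le_pdist (p j) (p K1));
    pose proof (pnorm_ge_0 (r L1)); unfold M; lra).
  assert (Hpk : pnorm (p k) <= M) by (pose proof (pnorm_le_pdist (p k) (p K1));
    pose proof (pnorm_ge_0 (r L1)); unfold M; lra).
  assert (Hrk : pnorm (r k) <= M - 1) by (pose proof (pnorm_le_pdist (r k) (r L1));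
    pose proof (pnorm_ge_0 (p K1)); unfold M; lra).
  assert (Hee : eps = M * (eps / (2 * M)) + (eps / (2 * M)) * M) by (field; lra).
  split.
  - eapply Rle_trans; [apply (pdist_triangle _ (pmul (p j) (r k)))|].
    rewrite Hee; apply Rplus_le_compat.
    + eapply Rle_trans; [apply pdist_pmul_l|].
      apply Rmult_le_compat; auto using pnorm_ge_0, pdist_ge_0.
    + eapply Rle_trans; [apply pdist_pmul_r|].
      apply Rmult_le_compat; auto using pnorm_ge_0, pdist_ge_0; lra.
  - intros x Hx; rewrite peval_pmul.
    replace (f x * g x - peval (p k) x * peval (r k) x)%C with
      (peval (p k) x * (g x - peval (r k) x) + (f x - peval (p k) x) * g x)%C by ring.
    eapply Rle_trans; [apply Cnorm_add|]; rewrite !Cnorm_mul, Hee.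
    apply Rplus_le_compat; apply Rmult_le_compat; auto using Cnorm_ge_0.
    + eapply Rle_trans; [apply Cnorm_peval, Hx|exact Hpk].
    + pose proof (Cnorm_add (g x - peval (r k) x) (peval (r k) x)) as H9.
      replace (g x - peval (r k) x + peval (r k) x)%C with (g x) in H9 by ring.
      specialize (H7 x Hx); pose proof (Cnorm_peval (r k) x Hx); lra.
Qed.

Lemma Pp_opp (f : Cplx -> Cplx) : Pp f -> Pp (fun x => - f x)%C.
Proof.
  intros Hf; apply (Pp_ext (fun x => (- (1)) * f x)%C); [intros; ring|].
  apply Pp_mul; [apply Pp_const|exact Hf].
Qed.

Lemma Pp_sub (f g : Cplx -> Cplx) : Pp f -> Pp g -> Pp (fun x => f x - g x)%C.
Proof. intros Hf Hg; apply Pp_add; [exact Hf|apply Pp_opp, Hg]. Qed.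

Lemma Pp_pow (f : Cplx -> Cplx) (n : nat) : Pp f -> Pp (fun x => Cpow (f x) n).
Proof.
  intros Hf; induction n as [|n IH]; simpl.
  - apply Pp_const.
  - apply Pp_mul; assumption.
Qed.

(** The l^1 distance dominates the supremum on the circle, so an l^1 Cauchy sequence converges
    uniformly to whatever its pointwise limit is. *)
Lemma Pp_pointwise (f : Cplx -> Cplx) (p : nat -> cpoly) :
  (forall eps, 0 < eps -> exists K : nat, forall j k : nat,
     (K <= j)%nat -> (K <= k)%nat -> pdist (p j) (p k) <= eps) ->
  (forall x, on_circle x -> forall eps, 0 < eps -> exists K : nat, forall k : nat,
     (K <= k)%nat -> Cnorm (f x - peval (p k) x) <= eps) ->
  Pp f.
Proof.
  intros Hc Hl; exists p; intros eps He.
  destruct (Hc eps He) as [K HK]; exists K; intros j k Hj Hk; split; [auto|].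
  intros x Hx; apply le_epsilon; intros e He'.
  destruct (Hl x Hx e He') as [L HL].
  pose proof (HL (max K L) ltac:(lia)) as H1.
  pose proof (HK (max K L) k ltac:(lia) Hk) as H2.
  pose proof (Cnorm_triangle (f x) (peval (p (max K L)) x) (peval (p k) x)).
  pose proof (Cnorm_peval_sub (p (max K L)) (p k) x Hx); lra.
Qed.

(** The form in which the iterations converging to [1 - Delta_plus] and to [1 / Delta_plus^2] are
    fed into [Pp]. *)
Lemma Pp_geometric (f : Cplx -> Cplx) (p : nat -> cpoly) (rho M : R) :
  0 <= rho < 1 -> 0 <= M ->
  (forall k, pdist (p (S k)) (p k) <= M * rho ^ k) ->
  (forall k x, on_circle x -> Cnorm (f x - peval (p k) x) <= M * rho ^ k) ->
  Pp f.
Proof.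
  intros Hrho HM Hd Hf.
  assert (Hd' : forall i k, pdist (p (i + k)%nat) (p k) <= M * rho ^ k / (1 - rho)).
  { intros i k.
    (* The factor [1 - rho ^ i] is the exact partial geometric sum; the bound without it would not
       be stable under the induction on [i]. *)
    assert (H : pdist (p (i + k)%nat) (p k) <= M * rho ^ k / (1 - rho) * (1 - rho ^ i)).
    { induction i as [|i IH]; simpl; [rewrite pdist_refl; lra|].
      pose proof (pdist_triangle (p (S (i + k))) (p (i + k)%nat) (p k)).
      pose proof (Hd (i + k)%nat) as H1; rewrite pow_add in H1.
      assert (M * rho ^ k / (1 - rho) * (1 - rho * rho ^ i) =
        M * (rho ^ i * rho ^ k) + M * rho ^ k / (1 - rho) * (1 - rho ^ i)) by (field; lra).
      lra. }
    pose proof (pow_le rho i ltac:(lra)); pose proof (pow_le rho k ltac:(lra)).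
    assert (0 <= M * rho ^ k / (1 - rho)).
    { apply Rmult_le_pos; [apply Rmult_le_pos; lra|].
      apply Rlt_le, Rinv_0_lt_compat; lra. }
    nra. }
  assert (Hz : forall eps, 0 < eps -> exists K, forall k, (K <= k)%nat ->
    M * rho ^ k / (1 - rho) <= eps /\ M * rho ^ k <= eps).
  { intros eps He.
    destruct (pow_lt_1_zero rho) with (y := eps * (1 - rho) / (M + 1)) as [K HK].
    - rewrite Rabs_right; lra.
    - apply Rdiv_lt_0_compat; [apply Rmult_lt_0_compat|]; lra.
    - exists K; intros k Hk; specialize (HK k Hk).
      pose proof (pow_le rho k ltac:(lra)).
      rewrite Rabs_right in HK by lra.
      assert (H1 : M * rho ^ k <= eps * (1 - rho)).
      { replace (eps * (1 - rho)) with ((M + 1) * (eps * (1 - rho) / (M + 1))) by (field; lra).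
        nra. }
      split; [|nra].
      apply Rmult_le_reg_r with (1 - rho); [lra|].
      unfold Rdiv; rewrite Rmult_assoc, Rinv_l; lra. }
  apply Pp_pointwise with p.
  - intros eps He; destruct (Hz (eps / 2)) as [K HK]; [lra|].
    exists K; intros j k Hj Hk.
    pose proof (Hd' (j - K)%nat K) as H1; pose proof (Hd' (k - K)%nat K) as H2.
    replace (j - K + K)%nat with j in H1 by lia; replace (k - K + K)%nat with k in H2 by lia.
    rewrite pdist_sym in H2; pose proof (pdist_triangle (p j) (p K) (p k)).
    destruct (HK K); [lia|]; lra.
  - intros x Hx eps He; destruct (Hz eps He) as [K HK]; exists K; intros k Hk.
    destruct (HK k Hk); pose proof (Hf k x Hx); lra.
Qed.

(** * From absolutely convergent Fourier series to limits of polynomials *)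

Lemma peval_map_seq (c : nat -> Cplx) (x : Cplx) (N i : nat) :
  (Cpow x i * peval (map c (seq i (S N))) x)%C =
  mkC (sum_f_R0 (fun k => Re (c (i + k)%nat * Cpow x (i + k))) N)
      (sum_f_R0 (fun k => Im (c (i + k)%nat * Cpow x (i + k))) N).
Proof.
  induction N as [|N IH].
  - apply Cplx_eq; cbn [sum_f_R0]; rewrite Nat.add_0_r; simpl; ring.
  - rewrite (seq_S (S N) i), map_app.
    assert (Ha : forall u v, peval (u ++ v) x = (peval u x + Cpow x (length u) * peval v x)%C).
    { clear; induction u as [|a u IH]; intros v; simpl; [ring|rewrite IH; ring]. }
    rewrite Ha, length_map, length_seq.
    replace (Cpow x i * (peval (map c (seq i (S N))) x + Cpow x (S N) * peval (map c [(i + S N)%nat]) x))%C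
      with (Cpow x i * peval (map c (seq i (S N))) x + c (i + S N)%nat * (Cpow x i * Cpow x (S N)))%C
      by (cbn [map peval]; ring).
    rewrite IH, <- Cpow_add; reflexivity.
Qed.

Lemma pdist_map_seq (c : nat -> Cplx) (i N k : nat) :
  pdist (map c (seq i (k + N))) (map c (seq i N)) = pnorm (map c (seq (i + N) k)).
Proof.
  revert i; induction N as [|N IH]; intros i.
  - rewrite Nat.add_0_r, Nat.add_0_r; simpl; apply pdist_nil_r.
  - rewrite Nat.add_succ_r; simpl; rewrite IH.
    replace (c i - c i)%C with 0%C by ring; rewrite Cnorm_0.
    replace (i + S N)%nat with (S i + N)%nat by lia; ring.
Qed.

Lemma pnorm_map_seq (c : nat -> Cplx) (N k : nat) :
  pnorm (map c (seq (S N) k)) =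
  sum_f_R0 (fun j => Cnorm (c j)) (k + N) - sum_f_R0 (fun j => Cnorm (c j)) N.
Proof.
  revert N; induction k as [|k IH]; intros N; [simpl; ring|].
  simpl seq; simpl map; simpl pnorm; rewrite IH.
  replace (k + S N)%nat with (S k + N)%nat by lia; simpl; ring.
Qed.

(** Two partial sums differ by a block of coefficients, whose l^1 norm is a difference of partial
    sums of the convergent series of [Cnorm (c k)]. *)
Lemma Pp_series (c : nat -> Cplx) (f : Cplx -> Cplx) (l : R) :
  infinite_sum (fun k => Cnorm (c k)) l ->
  (forall x, on_circle x -> Cseries_cv (fun k => c k * Cpow x k)%C (f x)) ->
  Pp f.
Proof.
  intros Hc Hf; apply Pp_pointwise with (fun N => map c (seq 0 (S N))).
  - intros eps He; destruct (Hc (eps / 2)) as [K HK]; [lra|].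
    assert (H : forall j k, (K <= k)%nat -> (k <= j)%nat ->
      pdist (map c (seq 0 (S j))) (map c (seq 0 (S k))) <= eps).
    { intros j k Hk Hj.
      replace (S j) with ((j - k) + S k)%nat by lia.
      rewrite pdist_map_seq, Nat.add_0_l, pnorm_map_seq.
      replace (j - k + k)%nat with j by lia.
      pose proof (HK k ltac:(lia)) as H1; pose proof (HK j ltac:(lia)) as H2.
      unfold Rdist in *; apply Rabs_def2 in H1; apply Rabs_def2 in H2; lra. }
    exists K; intros j k Hj Hk.
    destruct (Nat.le_ge_cases k j); [auto|rewrite pdist_sym; auto].
  - intros x Hx eps He; destruct (Hf x Hx) as [Hr Hi].
    destruct (Hr (eps / 2)) as [K HK]; [lra|]; destruct (Hi (eps / 2)) as [L HL]; [lra|].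
    exists (max K L); intros k Hk.
    pose proof (peval_map_seq c x k 0) as H; simpl Cpow in H.
    replace (peval (map c (seq 0 (S k))) x) with (1 * peval (map c (seq 0 (S k))) x)%C by ring.
    rewrite H; eapply Rle_trans; [apply Cnorm_le_parts|].
    specialize (HK k ltac:(lia)); specialize (HL k ltac:(lia)).
    unfold Rdist in *; rewrite Rabs_minus_sym in HK; rewrite Rabs_minus_sym in HL.
    cbn [Nat.add] in *.
    unfold Csub, Cadd, Copp; cbn [Re Im]; unfold Rminus in *; lra.
Qed.

Lemma infinite_sum_shift (u : nat -> R) (l : R) :
  infinite_sum (fun k => u (S k)) l -> infinite_sum u (u O + l).
Proof.
  intros H eps He; destruct (H eps He) as [K HK]; exists (S K); intros n Hn.
  destruct n as [|n]; [lia|].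
  rewrite decomp_sum by lia; simpl Nat.pred; unfold Rdist.
  replace (u O + sum_f_R0 (fun i => u (S i)) n - (u O + l)) with
    (sum_f_R0 (fun i => u (S i)) n - l) by ring.
  apply HK; lia.
Qed.

Lemma infinite_sum_0 (u : nat -> R) : (forall k, u k = 0) -> infinite_sum u 0.
Proof.
  intros H eps He; exists O; intros n _.
  assert (Hs : sum_f_R0 u n = 0) by (induction n; simpl; rewrite ?IHn, H; ring).
  rewrite Hs, Rdist_eq; exact He.
Qed.

Lemma infinite_sum_le (u v : nat -> R) (l : R) :
  infinite_sum v l -> (forall k, 0 <= u k <= v k) -> exists l', infinite_sum u l'.
Proof.
  intros Hv H; destruct (Rseries_CV_comp u v H (exist _ l Hv)) as [l' Hl']; exists l'; exact Hl'.
Qed.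

Lemma Cseries_cv_unique (u : nat -> Cplx) (z w : Cplx) :
  Cseries_cv u z -> Cseries_cv u w -> z = w.
Proof. intros [H1 H2] [H3 H4]; apply Cplx_eq; eapply uniqueness_sum; eauto. Qed.

Lemma Cseries_cv_0 (u : nat -> Cplx) : (forall k, u k = 0%C) -> Cseries_cv u 0%C.
Proof. intros H; split; apply infinite_sum_0; intros k; rewrite H; reflexivity. Qed.

Lemma Cseries_cv_shift (u : nat -> Cplx) (z : Cplx) :
  Cseries_cv (fun k => u (S k)) z -> Cseries_cv u (u O + z)%C.
Proof.
  intros [H1 H2]; split; simpl.
  - apply (infinite_sum_shift (fun k => Re (u k))), H1.
  - apply (infinite_sum_shift (fun k => Im (u k))), H2.
Qed.

Lemma Pp_wiener_plus (f : Cplx -> Cplx) (c : Z -> Cplx) :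
  wiener_repr f c -> (forall k, (k < 0)%Z -> c k = 0%C) -> Pp f.
Proof.
  intros [[S HS] Hf] Hc.
  destruct (infinite_sum_le (fun k => Cnorm (c (Z.of_nat k))) _ S HS) as [l Hl].
  { intros k; pose proof (Cnorm_ge_0 (c (Z.of_nat k)));
    pose proof (Cnorm_ge_0 (c (- Z.of_nat (Datatypes.S k))%Z)); lra. }
  apply (Pp_series (fun k => c (Z.of_nat k)) f l Hl).
  intros x Hx; destruct (Hf x Hx) as (lp & lm & Hp & Hm & ->).
  replace lm with 0%C.
  - replace (lp + 0)%C with lp by ring; exact Hp.
  - refine (Cseries_cv_unique _ _ _ (Cseries_cv_0 _ _) Hm).
    intros k; rewrite Hc by lia; ring.
Qed.

(** The substitution [x -> 1/x] reverses frequencies, so one predicate [Pp] serves for both halves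
    of the decomposition. *)
Lemma Pp_wiener_minus (f : Cplx -> Cplx) (c : Z -> Cplx) :
  wiener_repr f c -> (forall k, (0 < k)%Z -> c k = 0%C) -> Pp (fun x => f (/ x)%C).
Proof.
  intros [[S HS] Hf] Hc.
  destruct (infinite_sum_le (fun k => Cnorm (c (- Z.of_nat (Datatypes.S k))%Z)) _ S HS)
    as [l Hl].
  { intros k; pose proof (Cnorm_ge_0 (c (Z.of_nat k)));
    pose proof (Cnorm_ge_0 (c (- Z.of_nat (Datatypes.S k))%Z)); lra. }
  apply (Pp_series (fun k => c (- Z.of_nat k)%Z) _ _
    (infinite_sum_shift (fun k => Cnorm (c (- Z.of_nat k)%Z)) l Hl)).
  intros x Hx; destruct (Hf (/ x)%C (circle_inv x Hx)) as (lp & lm & Hp & Hm & Hfx).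
  rewrite Hfx, Cinv_inv in * by (apply circle_neq_0, Hx).
  (* In [wiener_repr] the constant term belongs to the series of [lp]; all other terms of [lp]
     vanish, and this one is put in front of the series of [lm], which starts at frequency 1 in
     [x]. *)
  replace lp with (c 0%Z * 1)%C.
  - apply (Cseries_cv_shift (fun k => c (- Z.of_nat k)%Z * Cpow x k)%C lm Hm).
  - transitivity (c 0%Z * 1 + 0)%C; [ring|].
    refine (Cseries_cv_unique _ _ _
      (Cseries_cv_shift (fun k => c (Z.of_nat k) * Cpow (/ x) k)%C 0%C
         (Cseries_cv_0 _ _)) Hp).
    intros k; rewrite Hc by lia; ring.
Qed.

(** * Averages over roots of unity and a Liouville argument *)

Fixpoint csum (g : nat -> Cplx) (N : nat) : Cplx :=
  match N with O => 0%C | S k => (csum g k + g k)%C end.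

Lemma csum_ext (g h : nat -> Cplx) (N : nat) : (forall i, g i = h i) -> csum g N = csum h N.
Proof. intros H; induction N as [|N IH]; simpl; [|rewrite IH, H]; reflexivity. Qed.

Lemma csum_add (g h : nat -> Cplx) (N : nat) :
  csum (fun i => g i + h i)%C N = (csum g N + csum h N)%C.
Proof. induction N as [|N IH]; simpl; [|rewrite IH]; ring. Qed.

Lemma csum_scale (c : Cplx) (g : nat -> Cplx) (N : nat) :
  csum (fun i => c * g i)%C N = (c * csum g N)%C.
Proof. induction N as [|N IH]; simpl; [|rewrite IH]; ring. Qed.

Lemma Cnorm_csum (g : nat -> Cplx) (N : nat) (M : R) :
  (forall i, Cnorm (g i) <= M) -> Cnorm (csum g N) <= INR N * M.
Proof.
  intros H; induction N as [|N IH]; simpl csum; [rewrite Cnorm_0; simpl; lra|].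
  eapply Rle_trans; [apply Cnorm_add|]; rewrite S_INR; specialize (H N); lra.
Qed.

(** Multiplication by [z - 1] telescopes the sum to [z^N - 1 = 0]. *)
Lemma csum_geometric (z : Cplx) (N : nat) :
  z <> 1%C -> Cpow z N = 1%C -> csum (Cpow z) N = 0%C.
Proof.
  intros Hz HN.
  assert (H : (csum (Cpow z) N * (z - 1))%C = (Cpow z N - 1)%C).
  { clear; induction N as [|N IH]; simpl.
    - simpl; ring.
    - replace ((csum (Cpow z) N + Cpow z N) * (z - 1))%C with
        (csum (Cpow z) N * (z - 1) + Cpow z N * (z - 1))%C by ring.
      rewrite IH; ring. }
  rewrite HN in H; replace (1 - 1)%C with 0%C in H by ring.
  destruct (Cplx_eq_dec (csum (Cpow z) N) 0%C) as [|Hn]; [assumption|].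
  exfalso; apply (Cmul_neq_0 _ (z - 1)%C Hn); [|exact H].
  intros H1; apply Hz; replace z with ((z - 1) + 1)%C by ring; rewrite H1; ring.
Qed.

Definition unity_root (N : nat) : Cplx := Cexpi (2 * PI / INR N).

Lemma Cexpi_neq_1 (t : R) : 0 < t < 2 * PI -> Cexpi t <> 1%C.
Proof.
  intros Ht H; apply (f_equal Re) in H; simpl in H.
  replace t with (2 * (t / 2)) in H by field.
  rewrite cos_2a_sin in H.
  assert (0 < sin (t / 2)) by (apply sin_gt_0; lra); nra.
Qed.

Lemma unity_root_pow (N : nat) : (0 < N)%nat -> Cpow (unity_root N) N = 1%C.
Proof.
  intros HN; apply lt_INR in HN; simpl in HN.
  unfold unity_root; rewrite Cexpi_pow.
  replace (INR N * (2 * PI / INR N)) with (2 * PI) by (field; lra).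
  apply Cplx_eq; simpl; [apply cos_2PI|apply sin_2PI].
Qed.

Lemma unity_root_primitive (N k : nat) :
  (0 < k < N)%nat -> Cpow (unity_root N) k <> 1%C.
Proof.
  intros [Hk HN]; apply lt_INR in Hk, HN; simpl in Hk.
  unfold unity_root; rewrite Cexpi_pow; apply Cexpi_neq_1.
  pose proof PI_RGT_0.
  replace (INR k * (2 * PI / INR N)) with (2 * PI * (INR k / INR N)) by (field; lra).
  assert (0 < INR k / INR N) by (apply Rdiv_lt_0_compat; lra).
  assert (INR k / INR N < 1) by (apply Rmult_lt_reg_r with (INR N); [lra|];
    unfold Rdiv; rewrite Rmult_assoc, Rinv_l; lra).
  nra.
Qed.

Lemma Cpow_comm (z : Cplx) (i j : nat) : Cpow (Cpow z i) j = Cpow (Cpow z j) i.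
Proof.
  assert (H : forall i j, Cpow (Cpow z i) j = Cpow z (i * j)).
  { clear; intros i j; induction j as [|j IH]; simpl.
    - rewrite Nat.mul_0_r; reflexivity.
    - rewrite IH, <- Cpow_add; f_equal; lia. }
  rewrite !H; f_equal; lia.
Qed.

(** Orthogonality of the characters of Z/N. The hypotheses say [|a - b| < N], so congruence of [a]
    and [b] modulo [N] already means equality. *)
Lemma csum_unity_monomial (N a b : nat) :
  (0 < N)%nat -> (a < b + N)%nat -> (b < a + N)%nat ->
  csum (fun i => let x := Cpow (unity_root N) i in Cpow x a * Cpow (/ x) b)%C N =
  if Nat.eq_dec a b then RtoC (INR N) else 0%C.
Proof.
  intros HN Ha Hb; set (w := unity_root N).
  assert (Hw : on_circle w) by apply circle_expi.
  assert (Hx : forall i, Cpow w i <> 0%C) by (intros; apply Cpow_neq_0, circle_neq_0, Hw).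
  destruct (Nat.eq_dec a b) as [->|Hab].
  - transitivity (csum (fun _ => 1%C) N).
    + apply csum_ext; intros i; apply Cpow_inv_r, Hx.
    + clear; induction N as [|N IH]; [reflexivity|].
      rewrite S_INR; simpl csum; rewrite IH; cplx.
  - destruct (Nat.lt_ge_cases a b) as [Hlt|Hge].
    + transitivity (csum (Cpow (Cpow (/ w) (b - a))) N).
      * apply csum_ext; intros i; cbv zeta.
        replace b with (a + (b - a))%nat at 1 by lia.
        rewrite Cpow_add.
        transitivity (Cpow (Cpow w i) a * Cpow (/ Cpow w i) a * Cpow (/ Cpow w i) (b - a))%C;
          [ring|].
        rewrite Cpow_inv_r, Cpow_comm by apply Hx.
        replace (/ Cpow w i)%C with (Cpow (/ w) i); [ring|].
        transitivity (Cpow w i * Cpow (/ w) i * / Cpow w i)%C; [field; apply Hx|].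
        rewrite Cpow_inv_r by (apply circle_neq_0, Hw); ring.
      * apply csum_geometric.
        -- intros H; apply (unity_root_primitive N (b - a)); [lia|].
           fold w; transitivity (Cpow w (b - a) * Cpow (/ w) (b - a))%C; [rewrite H; ring|].
           apply Cpow_inv_r, circle_neq_0, Hw.
        -- rewrite Cpow_comm; replace (Cpow (/ w) N) with 1%C; [apply Cpow_1|].
           rewrite <- (Cpow_inv_r w N) by (apply circle_neq_0, Hw).
           unfold w at 1; rewrite unity_root_pow by exact HN; ring.
    + transitivity (csum (Cpow (Cpow w (a - b))) N).
      * apply csum_ext; intros i; cbv zeta.
        replace a with ((a - b) + b)%nat at 1 by lia.
        rewrite Cpow_add.
        transitivity (Cpow (Cpow w i) (a - b) * (Cpow (Cpow w i) b * Cpow (/ Cpow w i) b))%C;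
          [ring|].
        rewrite Cpow_inv_r by apply Hx; rewrite Cpow_comm; ring.
      * apply csum_geometric.
        -- apply unity_root_primitive; lia.
        -- rewrite Cpow_comm; unfold w; rewrite unity_root_pow by exact HN; apply Cpow_1.
Qed.

(** A discrete substitute for the Fourier integral: [N] exceeds all exponents, so no other
    coefficient is aliased onto the one of degree [b - a]. *)
Lemma csum_unity_peval (N a b : nat) (p : cpoly) :
  (length p + a + b < N)%nat ->
  csum (fun i => let x := Cpow (unity_root N) i in peval p x * (Cpow x a * Cpow (/ x) b))%C N =
  (RtoC (INR N) * if le_dec a b then nth (b - a) p 0 else 0)%C.
Proof.
  revert a; induction p as [|c p IH]; intros a HN; simpl in HN.
  - transitivity (csum (fun i => 0 * 0)%C N); [apply csum_ext; intros; simpl; ring|].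
    rewrite csum_scale; destruct (le_dec a b); [destruct (b - a)%nat|]; simpl nth; ring.
  - transitivity (csum (fun i => c * (let x := Cpow (unity_root N) i in Cpow x a * Cpow (/ x) b) +
      (let x := Cpow (unity_root N) i in peval p x * (Cpow x (S a) * Cpow (/ x) b)))%C N).
    { apply csum_ext; intros; simpl; ring. }
    rewrite csum_add, csum_scale, csum_unity_monomial, IH by lia.
    destruct (Nat.eq_dec a b), (le_dec (S a) b), (le_dec a b); try lia.
    + subst; rewrite Nat.sub_diag; simpl nth; ring.
    + replace (b - a)%nat with (S (b - S a)) by lia; simpl nth; ring.
    + ring.
Qed.

(** Every exponent occurring is [d - j - i] with [i >= 0], hence negative but larger than [-N], and
    each monomial averages to 0. *)
Lemma csum_unity_peval_inv (N d j : nat) (p : cpoly) :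
  (d < j)%nat -> (length p + d + j < N)%nat ->
  csum (fun i => let x := Cpow (unity_root N) i in
                 peval p (/ x) * (Cpow x d * Cpow (/ x) j))%C N = 0%C.
Proof.
  revert j; induction p as [|c p IH]; intros j Hj HN; simpl in HN.
  - transitivity (csum (fun i => 0 * 0)%C N); [apply csum_ext; intros; simpl; ring|].
    rewrite csum_scale; ring.
  - transitivity (csum (fun i => c * (let x := Cpow (unity_root N) i in Cpow x d * Cpow (/ x) j) +
      (let x := Cpow (unity_root N) i in peval p (/ x) * (Cpow x d * Cpow (/ x) (S j))))%C N).
    { apply csum_ext; intros; simpl; ring. }
    rewrite csum_add, csum_scale, csum_unity_monomial, IH by lia.
    destruct (Nat.eq_dec d j); [lia|]; ring.
Qed.

(** Small coefficients alone do not bound the norm, as the length of [p] is not controlled. Only the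
    first [length r] coefficients are estimated by [eta]; those beyond are counted in full by
    [pdist p r]. With [r] a fixed late approximant both terms become small. *)
Lemma pnorm_le_length (p r : cpoly) (eta : R) :
  (forall j, Cnorm (nth j p 0%C) <= eta) -> pnorm p <= INR (length r) * eta + pdist p r.
Proof.
  intros H.
  assert (He : 0 <= eta) by (pose proof (H O); pose proof (Cnorm_ge_0 (nth 0 p 0%C)); lra).
  revert r H; induction p as [|a p IH]; intros r H.
  - pose proof (pos_INR (length r)); pose proof (pdist_ge_0 [] r); simpl pnorm; nra.
  - destruct r as [|b r]; [simpl; lra|].
    simpl length; rewrite S_INR; simpl.
    pose proof (IH r (fun j => H (S j))); pose proof (H O); simpl in *.
    pose proof (Cnorm_ge_0 (a - b)); lra.
Qed.

Lemma pdist_skipn (n : nat) (p r : cpoly) : pdist (skipn n p) (skipn n r) <= pdist p r.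
Proof.
  assert (Hn : forall n p, pnorm (skipn n p) <= pnorm p).
  { clear; induction n as [|n IH]; intros [|a p]; simpl; try lra.
    pose proof (IH p); pose proof (Cnorm_ge_0 a); lra. }
  revert p r; induction n as [|n IH]; intros [|a p] [|b r]; simpl; try lra.
  - pose proof (Hn n r); pose proof (Cnorm_ge_0 b); lra.
  - rewrite pdist_nil_r; pose proof (Hn n p); pose proof (Cnorm_ge_0 a); lra.
  - pose proof (IH p r); pose proof (Cnorm_ge_0 (a - b)); lra.
Qed.

Lemma peval_split (n : nat) (p : cpoly) (x : Cplx) :
  peval p x = (peval (map (fun j => nth j p 0%C) (seq 0 n)) x + Cpow x n * peval (skipn n p) x)%C.
Proof.
  revert p; induction n as [|n IH]; intros p; simpl; [ring|].
  rewrite <- seq_shift, map_map; destruct p as [|a p]; simpl.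
  - assert (H : peval (map (fun _ : nat => 0%C) (seq 0 n)) x = 0%C).
    { generalize (seq 0 n) as s; induction s as [|b s IHs]; simpl; [|rewrite IHs]; ring. }
    rewrite H; ring.
  - rewrite (IH p) at 1; ring.
Qed.

(** The limit comes in a sigma type, so that the limits of all coefficients can be collected into a
    function without a choice principle. *)
Lemma Cplx_complete (u : nat -> Cplx) :
  (forall eps, 0 < eps -> exists K : nat, forall j k : nat,
     (K <= j)%nat -> (K <= k)%nat -> Cnorm (u j - u k) <= eps) ->
  {z | forall eps, 0 < eps -> exists K : nat, forall k : nat,
     (K <= k)%nat -> Cnorm (u k - z) <= eps}.
Proof.
  intros H.
  assert (Hr : Cauchy_crit (fun k => Re (u k))).
  { intros eps He; destruct (H (eps / 2)) as [K HK]; [lra|]; exists K; intros j k Hj Hk.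
    pose proof (HK j k Hj Hk); pose proof (Re_le_Cnorm (u j - u k)) as H1.
    change (Re (u j - u k)%C) with (Re (u j) - Re (u k)) in H1; unfold Rdist; lra. }
  assert (Hi : Cauchy_crit (fun k => Im (u k))).
  { intros eps He; destruct (H (eps / 2)) as [K HK]; [lra|]; exists K; intros j k Hj Hk.
    pose proof (HK j k Hj Hk); pose proof (Im_le_Cnorm (u j - u k)) as H1.
    change (Im (u j - u k)%C) with (Im (u j) - Im (u k)) in H1; unfold Rdist; lra. }
  destruct (R_complete _ Hr) as [a Ha]; destruct (R_complete _ Hi) as [b Hb].
  exists (mkC a b); intros eps He.
  destruct (Ha (eps / 2)) as [K HK]; [lra|]; destruct (Hb (eps / 2)) as [L HL]; [lra|].
  exists (max K L); intros k Hk.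
  specialize (HK k ltac:(lia)); specialize (HL k ltac:(lia)); unfold Rdist in *.
  eapply Rle_trans; [apply Cnorm_le_parts|].
  unfold Csub, Cadd, Copp; cbn [Re Im]; unfold Rminus in *; lra.
Qed.

Lemma pdist_map_small (s : list nat) (c : nat -> nat -> Cplx) (t : nat -> Cplx) :
  (forall j eps, 0 < eps -> exists K : nat, forall k, (K <= k)%nat -> Cnorm (c k j - t j) <= eps) ->
  forall eps, 0 < eps -> exists K : nat, forall k, (K <= k)%nat ->
    pdist (map (c k) s) (map t s) <= eps.
Proof.
  intros H; induction s as [|j s IH]; intros eps He.
  - exists O; intros; simpl; lra.
  - destruct (H j (eps / 2)) as [K HK]; [lra|]; destruct (IH (eps / 2)) as [L HL]; [lra|].
    exists (max K L); intros k Hk; simpl.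
    specialize (HK k ltac:(lia)); specialize (HL k ltac:(lia)); lra.
Qed.

(* The coefficients of the approximating polynomials beyond degree [d] are averages of a
   uniformly small function over roots of unity, hence tend to 0. *)
Lemma Pp_liouville (f g : Cplx -> Cplx) (d : nat) :
  Pp f -> Pp g -> (forall x, on_circle x -> f x = Cpow x d * g (/ x))%C ->
  exists t : nat -> Cplx, forall x, on_circle x -> f x = peval (map t (seq 0 (S d))) x.
Proof.
  intros [p Hp] [r Hr] Hfg.
  assert (Hhigh : forall eps, 0 < eps -> exists K : nat, forall k j : nat,
    (K <= k)%nat -> (d < j)%nat -> Cnorm (nth j (p k) 0%C) <= eps).
  { intros eps He.
    destruct (Hp (eps / 2)) as [K HK]; [lra|]; destruct (Hr (eps / 2)) as [L HL]; [lra|].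
    exists (max K L); intros k j Hk Hj.
    destruct (HK k k) as [_ H1]; [lia..|]; destruct (HL k k) as [_ H2]; [lia..|].
    (* Large enough to exclude aliasing in both averages that follow. *)
    set (N := S (length (p k) + length (r k) + d + j)).
    pose proof (csum_unity_peval N 0 j (p k) ltac:(lia)) as E1.
    pose proof (csum_unity_peval_inv N d j (r k) Hj ltac:(lia)) as E2.
    destruct (le_dec 0 j); [|lia]; rewrite Nat.sub_0_r in E1.
    assert (HN : 0 < INR N) by (apply lt_0_INR; lia).
    apply Rmult_le_reg_l with (INR N); [exact HN|].
    (* Subtracting the second average, which is 0, changes nothing in value, but turns the summand
       into the difference of two approximations of [f x], one by [p k] and one by [x^d] times [r k]
       at [1/x], each within [eps / 2]. *)
    replace (INR N * Cnorm (nth j (p k) 0%C)) with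
      (Cnorm (RtoC (INR N) * nth j (p k) 0 + RtoC (-1) * 0)%C).
    - rewrite <- E1 at 1; rewrite <- E2 at 1; rewrite <- csum_scale, <- csum_add.
      apply Cnorm_csum; intros i; cbv zeta.
      set (x := Cpow (unity_root N) i).
      assert (Hx : on_circle x) by apply Cnorm_pow_circle, circle_expi.
      replace (peval (p k) x * (Cpow x 0 * Cpow (/ x) j) +
        RtoC (-1) * (peval (r k) (/ x) * (Cpow x d * Cpow (/ x) j)))%C with
        (((f x - Cpow x d * peval (r k) (/ x)) - (f x - peval (p k) x)) * Cpow (/ x) j)%C.
      + rewrite Cnorm_mul, Cnorm_pow_circle, Rmult_1_r by (apply circle_inv, Hx).
        eapply Rle_trans; [apply Cnorm_sub|]; specialize (H1 x Hx).
        rewrite (Hfg x Hx) at 1.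
        replace (Cpow x d * g (/ x) - Cpow x d * peval (r k) (/ x))%C with
          (Cpow x d * (g (/ x) - peval (r k) (/ x)))%C by ring.
        rewrite Cnorm_mul, Cnorm_pow_circle by exact Hx.
        specialize (H2 (/ x)%C (circle_inv x Hx)); lra.
      + replace (RtoC (-1)) with (- (1))%C by cplx; simpl Cpow; ring.
    - replace (RtoC (INR N) * nth j (p k) 0 + RtoC (-1) * 0)%C with
        (RtoC (INR N) * nth j (p k) 0)%C by ring.
      rewrite Cnorm_mul, Cnorm_RtoC, Rabs_right; lra. }
  assert (Htail : forall eps, 0 < eps -> exists K : nat, forall k, (K <= k)%nat ->
    pnorm (skipn (S d) (p k)) <= eps).
  { intros eps He; destruct (Hp (eps / 2)) as [K HK]; [lra|].
    set (L := INR (length (skipn (S d) (p K)))).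
    assert (HL : 0 <= L) by apply pos_INR.
    destruct (Hhigh (eps / 2 / (L + 1))) as [K' HK'];
      [apply Rdiv_lt_0_compat; lra|].
    exists (max K K'); intros k Hk.
    eapply Rle_trans; [apply (pnorm_le_length _ (skipn (S d) (p K)) (eps / 2 / (L + 1)))|].
    - intros j; rewrite nth_skipn; apply HK'; lia.
    - fold L; pose proof (pdist_skipn (S d) (p k) (p K)).
      destruct (HK k K) as [H1 _]; [lia..|].
      assert (L * (eps / 2 / (L + 1)) <= eps / 2).
      { replace (eps / 2) with ((L + 1) * (eps / 2 / (L + 1))) at 2 by (field; lra).
        apply Rmult_le_compat_r; [|lra].
        apply Rlt_le, Rdiv_lt_0_compat; lra. }
      lra. }
  assert (Ht : forall j, {z | forall eps, 0 < eps -> exists K : nat, forall k : nat,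
    (K <= k)%nat -> Cnorm (nth j (p k) 0%C - z) <= eps}).
  { intros j; apply (Cplx_complete (fun k => nth j (p k) 0%C)).
    intros eps He; destruct (Hp eps He) as [K HK]; exists K; intros i k Hi Hk.
    eapply Rle_trans; [apply Cnorm_nth_sub|]; apply HK; assumption. }
  (* The limit polynomial has the coefficientwise limits up to degree [d]. The error splits into
     approximation of [f], convergence of the low coefficients, and the vanishing tail. *)
  pose (t := fun j => proj1_sig (Ht j)); exists t; intros x Hx.
  apply eq_of_Cnorm_small; intros eps He.
  destruct (Hp (eps / 3)) as [K1 HK1]; [lra|].
  destruct (Htail (eps / 3)) as [K2 HK2]; [lra|].
  destruct (pdist_map_small (seq 0 (S d)) (fun k j => nth j (p k) 0%C) t
    (fun j => proj2_sig (Ht j)) (eps / 3)) as [K3 HK3]; [lra|].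
  set (k := max K1 (max K2 K3)).
  destruct (HK1 k k) as [_ H1]; [lia..|]; specialize (H1 x Hx).
  specialize (HK2 k ltac:(lia)); specialize (HK3 k ltac:(lia)).
  rewrite (peval_split (S d)) in H1.
  set (lo := map (fun j => nth j (p k) 0%C) (seq 0 (S d))) in *.
  set (T := map t (seq 0 (S d))) in *.
  replace (f x - peval T x)%C with
    ((f x - (peval lo x + Cpow x (S d) * peval (skipn (S d) (p k)) x)) +
     (peval lo x - peval T x) + Cpow x (S d) * peval (skipn (S d) (p k)) x)%C by ring.
  eapply Rle_trans; [apply Cnorm_add|].
  eapply Rle_trans; [apply Rplus_le_compat_r, Cnorm_add|].
  rewrite (Cnorm_mul (Cpow x (S d))), Cnorm_pow_circle by exact Hx.
  pose proof (Cnorm_peval (skipn (S d) (p k)) x Hx).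
  pose proof (Cnorm_peval_sub lo T x Hx); lra.
Qed.

(** * Derivatives along the circle *)

Definition ccont (f : Cplx -> Cplx) (x : Cplx) : Prop :=
  forall eps, 0 < eps -> exists delta, 0 < delta /\
    forall y, on_circle y -> Cnorm (y - x) < delta -> Cnorm (f y - f x) < eps.

Lemma ccont_const (c x : Cplx) : ccont (fun _ => c) x.
Proof.
  intros eps He; exists 1; split; [lra|]; intros.
  replace (c - c)%C with 0%C by ring; rewrite Cnorm_0; exact He.
Qed.

Lemma ccont_id (x : Cplx) : ccont (fun y => y) x.
Proof. intros eps He; exists eps; auto. Qed.

Lemma ccont_ext (f g : Cplx -> Cplx) (x : Cplx) :
  on_circle x -> (forall y, on_circle y -> f y = g y) -> ccont f x -> ccont g x.
Proof.
  intros Hx H Hf eps He; destruct (Hf eps He) as [d [Hd H1]]; exists d; split; [exact Hd|].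
  intros y Hy Hyx; rewrite <- !H by assumption; auto.
Qed.

Lemma ccont_add (f g : Cplx -> Cplx) (x : Cplx) :
  ccont f x -> ccont g x -> ccont (fun y => f y + g y)%C x.
Proof.
  intros Hf Hg eps He.
  destruct (Hf (eps / 2)) as [d [Hd H1]]; [lra|].
  destruct (Hg (eps / 2)) as [d' [Hd' H2]]; [lra|].
  exists (Rmin d d'); split; [apply Rmin_pos; assumption|]; intros y Hy Hyx.
  apply Rmin_Rgt in Hyx; destruct Hyx as [Hy1 Hy2].
  replace (f y + g y - (f x + g x))%C with ((f y - f x) + (g y - g x))%C by ring.
  eapply Rle_lt_trans; [apply Cnorm_add|].
  specialize (H1 y Hy Hy1); specialize (H2 y Hy Hy2); lra.
Qed.

Lemma ccont_mul (f g : Cplx -> Cplx) (x : Cplx) :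
  ccont f x -> ccont g x -> ccont (fun y => f y * g y)%C x.
Proof.
  intros Hf Hg eps He.
  set (M := Cnorm (f x) + Cnorm (g x) + 1).
  pose proof (Cnorm_ge_0 (f x)); pose proof (Cnorm_ge_0 (g x)).
  assert (HM : 1 <= M) by (unfold M; lra).
  assert (He' : 0 < eps / (2 * M)) by (apply Rdiv_lt_0_compat; lra).
  destruct (Hf _ He') as [d [Hd H1]].
  destruct (Hg (Rmin 1 (eps / (2 * M)))) as [d' [Hd' H2]]; [apply Rmin_pos; lra|].
  exists (Rmin d d'); split; [apply Rmin_pos; assumption|]; intros y Hy Hyx.
  apply Rmin_Rgt in Hyx; destruct Hyx as [Hy1 Hy2].
  specialize (H1 y Hy Hy1); specialize (H2 y Hy Hy2).
  apply Rmin_Rgt in H2; destruct H2 as [H2 H3].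
  replace (f y * g y - f x * g x)%C with ((f y - f x) * g y + f x * (g y - g x))%C by ring.
  eapply Rle_lt_trans; [apply Cnorm_add|]; rewrite !Cnorm_mul.
  assert (Hgy : Cnorm (g y) <= M).
  { pose proof (Cnorm_add (g y - g x) (g x)) as H4.
    replace (g y - g x + g x)%C with (g y) in H4 by ring; unfold M; lra. }
  replace eps with (eps / (2 * M) * M + M * (eps / (2 * M))) by (field; lra).
  pose proof (Cnorm_ge_0 (f y - f x)); pose proof (Cnorm_ge_0 (g y - g x)).
  pose proof (Cnorm_ge_0 (g y)).
  assert (Hfx : Cnorm (f x) <= M) by (unfold M; lra).
  apply Rplus_lt_le_compat; [|apply Rmult_le_compat; lra].
  apply Rle_lt_trans with (Cnorm (f y - f x) * M).
  - apply Rmult_le_compat_l; assumption.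
  - apply Rmult_lt_compat_r; lra.
Qed.

Lemma ccont_opp (f : Cplx -> Cplx) (x : Cplx) : ccont f x -> ccont (fun y => - f y)%C x.
Proof.
  intros Hf eps He; destruct (Hf eps He) as [d [Hd H]]; exists d; split; [exact Hd|].
  intros y Hy Hyx; replace (- f y - - f x)%C with (- (f y - f x))%C by ring.
  rewrite Cnorm_opp; auto.
Qed.

Lemma ccont_inv (f : Cplx -> Cplx) (x : Cplx) :
  (forall y, on_circle y -> f y <> 0%C) -> on_circle x ->
  ccont f x -> ccont (fun y => / f y)%C x.
Proof.
  intros Hne Hx Hf eps He.
  set (M := Cnorm (f x)).
  assert (HM : 0 < M) by apply Cnorm_pos, Hne, Hx.
  destruct (Hf (Rmin (M / 2) (eps * (M * M / 2)))) as [d [Hd H]].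
  { apply Rmin_pos; [lra|]; apply Rmult_lt_0_compat; [lra|]; nra. }
  exists d; split; [exact Hd|]; intros y Hy Hyx; specialize (H y Hy Hyx).
  apply Rmin_Rgt in H; destruct H as [H1 H2].
  assert (Hfy : M / 2 < Cnorm (f y)).
  { pose proof (Cnorm_sub (f y) (f y - f x)) as H3.
    replace (f y - (f y - f x))%C with (f x) in H3 by ring; fold M in H3; lra. }
  replace (/ f y - / f x)%C with (- (f y - f x) * / (f y * f x))%C by
    (field; split; apply Hne; assumption).
  rewrite Cnorm_mul, Cnorm_opp, Cnorm_inv, Cnorm_mul by (apply Cmul_neq_0; apply Hne; assumption).
  fold M; apply Rmult_lt_reg_r with (Cnorm (f y) * M); [nra|].
  rewrite Rmult_assoc, Rinv_l, Rmult_1_r by nra.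
  eapply Rlt_le_trans; [exact H2|]; apply Rmult_le_compat_l; nra.
Qed.

Lemma ccont_comp_isometry (f tau : Cplx -> Cplx) (x : Cplx) :
  (forall y, on_circle y -> on_circle (tau y) /\ Cnorm (tau y - tau x) = Cnorm (y - x)) ->
  ccont f (tau x) -> ccont (fun y => f (tau y)) x.
Proof.
  intros Ht Hf eps He; destruct (Hf eps He) as [d [Hd H]]; exists d; split; [exact Hd|].
  intros y Hy Hyx; destruct (Ht y Hy) as [H1 H2]; apply H; [exact H1|rewrite H2; exact Hyx].
Qed.

Lemma Cnorm_inv_sub (x y : Cplx) :
  on_circle x -> on_circle y -> Cnorm (/ y - / x) = Cnorm (y - x).
Proof.
  intros Hx Hy; pose proof (circle_neq_0 x Hx); pose proof (circle_neq_0 y Hy).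
  replace (/ y - / x)%C with ((x - y) * / (x * y))%C by (field; split; assumption).
  rewrite Cnorm_mul, Cnorm_inv, Cnorm_mul, Hx, Hy, (Cnorm_sub_sym x y)
    by (apply Cmul_neq_0; assumption).
  field.
Qed.

(** Without nearby points of the circle the Caratheodory factor would not have a determined value at
    [x]; this is what makes derivatives unique. *)
Lemma circle_nonisolated (x : Cplx) (d : R) :
  on_circle x -> 0 < d -> exists y, on_circle y /\ y <> x /\ Cnorm (y - x) < d.
Proof.
  intros Hx Hd.
  destruct (continuity_cos 0 (d / 2)) as [a [Ha Hcos]]; [lra|].
  destruct (continuity_sin 0 (d / 2)) as [b [Hb Hsin]]; [lra|].
  pose (t := Rmin 1 (Rmin a b) / 2).
  assert (Ht : 0 < t) by (unfold t; repeat apply Rmin_case; lra).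
  assert (Ht1 : t < 1 /\ t < a /\ t < b) by
    (unfold t; repeat apply Rmin_case_strong; intros; lra).
  exists (x * Cexpi t)%C; split; [apply circle_mul; [exact Hx|apply circle_expi]|].
  pose proof PI2_1.
  split.
  - intros H1; apply (Cexpi_neq_1 t); [lra|].
    replace (Cexpi t) with (/ x * (x * Cexpi t))%C by (field; apply circle_neq_0, Hx).
    rewrite H1; field; apply circle_neq_0, Hx.
  - replace (x * Cexpi t - x)%C with (x * (Cexpi t - 1))%C by ring.
    rewrite Cnorm_mul, Hx, Rmult_1_l.
    eapply Rle_lt_trans; [apply Cnorm_le_parts|].
    assert (Hdist : forall c, t < c -> D_x no_cond 0 t /\ Rdist t 0 < c).
    { intros c Hc; split; [split; [exact I|lra]|].
      unfold Rdist; rewrite Rminus_0_r, Rabs_right; lra. }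
    specialize (Hcos t (Hdist a ltac:(lra))); specialize (Hsin t (Hdist b ltac:(lra))).
    cbn in Hcos, Hsin; unfold Rdist in *; rewrite cos_0 in Hcos; rewrite sin_0 in Hsin.
    change (Re (Cexpi t - 1)%C) with (cos t - 1); change (Im (Cexpi t - 1)%C) with (sin t - 0); lra.
Qed.

(* [E] is the value at [x] of [lambda d/dlambda f], in Caratheodory form. *)
Definition ldiff (f : Cplx -> Cplx) (x E : Cplx) : Prop :=
  exists phi, ccont phi x /\ phi x = E /\
    forall y, on_circle y -> (f y - f x)%C = (phi y * (y * / x - 1))%C.

Lemma ldiff_ext (f g : Cplx -> Cplx) (x E E' : Cplx) :
  on_circle x -> (forall y, on_circle y -> f y = g y) -> E = E' -> ldiff f x E -> ldiff g x E'.
Proof.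
  intros Hx H <- (phi & H1 & H2 & H3); exists phi; repeat split; try assumption.
  intros y Hy; rewrite <- !H by assumption; auto.
Qed.

Lemma ldiff_const (c x : Cplx) : ldiff (fun _ => c) x 0.
Proof. exists (fun _ => 0%C); repeat split; [apply ccont_const|]; intros; ring. Qed.

Lemma ldiff_id (x : Cplx) : on_circle x -> ldiff (fun y => y) x x.
Proof.
  intros Hx; exists (fun _ => x); repeat split; [apply ccont_const|].
  intros; field; apply circle_neq_0, Hx.
Qed.

Lemma ldiff_add (f g : Cplx -> Cplx) (x E E' : Cplx) :
  ldiff f x E -> ldiff g x E' -> ldiff (fun y => f y + g y)%C x (E + E').
Proof.
  intros (phi & H1 & H2 & H3) (psi & H4 & H5 & H6).
  exists (fun y => phi y + psi y)%C; repeat split.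
  - apply ccont_add; assumption.
  - rewrite H2, H5; reflexivity.
  - intros y Hy; replace (f y + g y - (f x + g x))%C with ((f y - f x) + (g y - g x))%C by ring.
    rewrite H3, H6 by exact Hy; ring.
Qed.

Lemma ldiff_cont (f : Cplx -> Cplx) (x E : Cplx) : on_circle x -> ldiff f x E -> ccont f x.
Proof.
  intros Hx (phi & H1 & H2 & H3).
  apply (ccont_ext (fun y => phi y * (y * / x + - (1)) + f x)%C); [exact Hx| |].
  - intros y Hy; replace (f y) with ((f y - f x) + f x)%C by ring.
    rewrite H3 by exact Hy; ring.
  - apply ccont_add; [apply ccont_mul; [exact H1|]|apply ccont_const].
    apply ccont_add; [apply ccont_mul|]; auto using ccont_id, ccont_const.
Qed.

Lemma ldiff_mul (f g : Cplx -> Cplx) (x E E' : Cplx) :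
  on_circle x -> ldiff f x E -> ldiff g x E' ->
  ldiff (fun y => f y * g y)%C x (E * g x + f x * E').
Proof.
  intros Hx Hf Hg; pose proof (ldiff_cont g x E' Hx Hg) as Hc.
  destruct Hf as (phi & H1 & H2 & H3), Hg as (psi & H4 & H5 & H6).
  exists (fun y => phi y * g y + f x * psi y)%C; repeat split.
  - apply ccont_add; apply ccont_mul; auto using ccont_const.
  - rewrite H2, H5; reflexivity.
  - intros y Hy.
    replace (f y * g y - f x * g x)%C with ((f y - f x) * g y + f x * (g y - g x))%C by ring.
    rewrite H3, H6 by exact Hy; ring.
Qed.

Lemma ldiff_inv (f : Cplx -> Cplx) (x E : Cplx) :
  (forall y, on_circle y -> f y <> 0%C) -> on_circle x -> ldiff f x E ->
  ldiff (fun y => / f y)%C x (- (E * / (f x * f x))).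
Proof.
  intros Hne Hx Hf; pose proof (ldiff_cont f x E Hx Hf) as Hc.
  destruct Hf as (phi & H1 & H2 & H3).
  exists (fun y => - (phi y * (/ f y * / f x)))%C; repeat split.
  - apply ccont_opp, ccont_mul; [exact H1|].
    apply ccont_mul; [apply ccont_inv; assumption|apply ccont_const].
  - rewrite H2; field; auto.
  - intros y Hy.
    replace (/ f y - / f x)%C with (- ((f y - f x) * (/ f y * / f x)))%C by
      (field; split; apply Hne; assumption).
    rewrite H3 by exact Hy; ring.
Qed.

(** From [g y - g x = (f y - f x) / (g y + g x)]. Positive real parts keep the denominator at least
    [Re (g x)] in modulus, which gives first the continuity of [g] and then the derivative. *)
Lemma ldiff_sqrt (f g : Cplx -> Cplx) (x E : Cplx) :
  (forall y, on_circle y -> 0 < Re (g y)) -> (forall y, on_circle y -> (g y * g y)%C = f y) ->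
  on_circle x -> ldiff f x E -> ldiff g x (E * / (g x + g x)).
Proof.
  intros Hg Hgf Hx Hf; pose proof (ldiff_cont f x E Hx Hf) as Hc.
  destruct Hf as (phi & H1 & H2 & H3).
  assert (Hne : forall y, on_circle y -> (g y + g x)%C <> 0%C).
  { intros y Hy H; apply (f_equal Re) in H; simpl in H.
    specialize (Hg y Hy) as Ha; specialize (Hg x Hx) as Hb; lra. }
  assert (Hsub : forall y, on_circle y -> (g y - g x)%C = ((f y - f x) * / (g y + g x))%C).
  { intros y Hy; rewrite <- !Hgf by assumption; field; apply Hne, Hy. }
  assert (Hgc : ccont g x).
  { intros eps He.
    set (r := Re (g x)); assert (Hr : 0 < r) by apply Hg, Hx.
    destruct (Hc (eps * r)) as [d [Hd H]]; [nra|]; exists d; split; [exact Hd|].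
    intros y Hy Hyx; specialize (H y Hy Hyx).
    rewrite Hsub, Cnorm_mul, Cnorm_inv by auto.
    assert (Hlb : r <= Cnorm (g y + g x)).
    { pose proof (Re_le_Cnorm (g y + g x)) as H4; simpl in H4.
      pose proof (Hg y Hy); fold r in H4; rewrite Rabs_right in H4 by lra; lra. }
    apply Rmult_lt_reg_r with (Cnorm (g y + g x)); [lra|].
    rewrite Rmult_assoc, Rinv_l, Rmult_1_r by lra.
    eapply Rlt_le_trans; [exact H|]; apply Rmult_le_compat_l; lra. }
  exists (fun y => phi y * / (g y + g x))%C; repeat split.
  - apply ccont_mul; [exact H1|].
    apply (ccont_inv (fun y => g y + g x)%C); auto.
    apply ccont_add; [exact Hgc|apply ccont_const].
  - rewrite H2; reflexivity.
  - intros y Hy; rewrite Hsub, H3 by exact Hy; ring.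
Qed.

Lemma ldiff_comp_inv (f : Cplx -> Cplx) (x E : Cplx) :
  on_circle x -> ldiff f (/ x) E -> ldiff (fun y => f (/ y)%C) x (- E).
Proof.
  intros Hx (phi & H1 & H2 & H3).
  (* From [x/y - 1 = - (x/y) (y/x - 1)]. *)
  exists (fun y => - (phi (/ y) * (x * / y)))%C; repeat split.
  - apply ccont_opp, ccont_mul.
    + apply ccont_comp_isometry; [|exact H1].
      intros y Hy; split; [apply circle_inv, Hy|apply Cnorm_inv_sub; assumption].
    + apply ccont_mul; [apply ccont_const|].
      apply (ccont_inv (fun y => y)); auto using circle_neq_0, ccont_id.
  - rewrite H2; field; apply circle_neq_0, Hx.
  - intros y Hy; rewrite H3 by apply circle_inv, Hy.
    rewrite Cinv_inv by apply circle_neq_0, Hx.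
    field; split; apply circle_neq_0; assumption.
Qed.

(** The quotient [y/x] is unchanged when both signs are flipped, so no sign appears, unlike for the
    ordinary derivative. *)
Lemma ldiff_comp_opp (f : Cplx -> Cplx) (x E : Cplx) :
  on_circle x -> ldiff f (- x) E -> ldiff (fun y => f (- y)%C) x E.
Proof.
  intros Hx (phi & H1 & H2 & H3).
  exists (fun y => phi (- y)%C); repeat split; [|exact H2|].
  - apply ccont_comp_isometry; [|exact H1].
    intros y Hy; split; [apply circle_opp, Hy|].
    replace (- y - - x)%C with (- (y - x))%C by ring; apply Cnorm_opp.
  - intros y Hy; rewrite H3 by apply circle_opp, Hy.
    field; split; [apply circle_neq_0, Hx|].
    apply circle_neq_0, (circle_opp x Hx).
Qed.

Lemma Cconj_add (z w : Cplx) : Cconj (z + w) = (Cconj z + Cconj w)%C.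
Proof. cplx. Qed.
Lemma Cconj_opp (z : Cplx) : Cconj (- z) = (- Cconj z)%C.
Proof. cplx. Qed.
Lemma Cconj_sub (z w : Cplx) : Cconj (z - w) = (Cconj z - Cconj w)%C.
Proof. cplx. Qed.
Lemma Cconj_mul (z w : Cplx) : Cconj (z * w) = (Cconj z * Cconj w)%C.
Proof. cplx. Qed.
Lemma Cconj_conj (z : Cplx) : Cconj (Cconj z) = z.
Proof. cplx. Qed.
Lemma Cconj_1 : Cconj 1 = 1%C.
Proof. cplx. Qed.
Lemma Cconj_inv (z : Cplx) : Cconj (/ z) = (/ Cconj z)%C.
Proof.
  unfold Cconj, Cinv; cbn [Re Im].
  replace (- Im z * - Im z) with (Im z * Im z) by ring.
  apply Cplx_eq; cbn [Re Im]; unfold Rdiv; ring.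
Qed.

Lemma ldiff_comp_conj (f : Cplx -> Cplx) (x E : Cplx) :
  on_circle x -> ldiff f (Cconj x) E -> ldiff (fun y => Cconj (f (Cconj y))) x (Cconj E).
Proof.
  intros Hx (phi & H1 & H2 & H3).
  exists (fun y => Cconj (phi (Cconj y))); repeat split; [|rewrite H2; reflexivity|].
  - intros eps He; destruct (H1 eps He) as [d [Hd H]]; exists d; split; [exact Hd|].
    intros y Hy Hyx; rewrite <- Cconj_sub, Cnorm_conj; apply H; [apply circle_conj, Hy|].
    rewrite <- Cconj_sub, Cnorm_conj; exact Hyx.
  - intros y Hy; rewrite <- Cconj_sub, H3 by apply circle_conj, Hy.
    rewrite Cconj_mul, Cconj_sub, Cconj_mul, Cconj_inv, !Cconj_conj, Cconj_1; reflexivity.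
Qed.

Lemma ldiff_unique (f : Cplx -> Cplx) (x E E' : Cplx) :
  on_circle x -> ldiff f x E -> ldiff f x E' -> E = E'.
Proof.
  intros Hx (phi & H1 & <- & H3) (psi & H4 & <- & H6).
  apply eq_of_Cnorm_small; intros eps He.
  destruct (H1 (eps / 2)) as [d [Hd Ha]]; [lra|].
  destruct (H4 (eps / 2)) as [d' [Hd' Hb]]; [lra|].
  destruct (circle_nonisolated x (Rmin d d') Hx) as (y & Hy & Hyx & Hn);
    [apply Rmin_pos; assumption|].
  apply Rmin_Rgt in Hn; destruct Hn as [Hn1 Hn2].
  specialize (Ha y Hy Hn1); specialize (Hb y Hy Hn2).
  pose proof (circle_neq_0 x Hx) as Hx0.
  assert (Hne : (y * / x - 1)%C <> 0%C).
  { intros H; apply Hyx; replace y with (x * ((y * / x - 1) + 1))%C by (field; exact Hx0).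
    rewrite H; ring. }
  assert (Heq : phi y = psi y).
  { pose proof (H3 y Hy) as Ez; rewrite (H6 y Hy) in Ez.
    generalize dependent (y * / x - 1)%C; intros z Hz Ez.
    replace (phi y) with (phi y * z * / z)%C by (field; exact Hz).
    rewrite <- Ez; field; exact Hz. }
  rewrite Heq in Ha; rewrite Cnorm_sub_sym in Ha.
  pose proof (Cnorm_triangle (phi x) (psi y) (psi x)); lra.
Qed.

(** The factor [x] in [x p'(x)] is kept explicit: it later absorbs one of the two negative powers in
    [Delta_minus^2 = 1 + Q^2/x^2]. *)
Lemma ldiff_peval (p : cpoly) :
  exists r : cpoly, forall x, on_circle x -> ldiff (peval p) x (x * peval r x).
Proof.
  induction p as [|a p [r IH]].
  - exists []; intros x Hx; simpl peval.
    apply (ldiff_ext (fun _ => 0%C) _ _ 0%C); auto using ldiff_const; ring.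
  - exists (padd p (0%C :: r)); intros x Hx; simpl.
    eapply (ldiff_ext (fun y => a + y * peval p y)%C); [exact Hx|reflexivity| |].
    2: { apply ldiff_add; [apply ldiff_const|].
         apply ldiff_mul; [exact Hx|apply ldiff_id, Hx|apply IH, Hx]. }
    rewrite peval_padd; simpl peval; ring.
Qed.

(** * The functions Delta *)

Lemma Csqrt_sqr (z : Cplx) : (Csqrt z * Csqrt z)%C = z.
Proof.
  pose proof (Re_le_Cnorm z) as H.
  pose proof (Rle_abs (Re z)); pose proof (Rle_abs (- Re z)); rewrite Rabs_Ropp in *.
  pose proof (Cnorm_sqr z) as Hn.
  set (r := Cnorm z) in *.
  assert (Ha : sqrt ((r + Re z) / 2) * sqrt ((r + Re z) / 2) = (r + Re z) / 2)
    by (apply sqrt_sqrt; lra).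
  assert (Hb : sqrt ((r - Re z) / 2) * sqrt ((r - Re z) / 2) = (r - Re z) / 2)
    by (apply sqrt_sqrt; lra).
  (* The product under the roots is [(Im z / 2)^2]; the sign chosen in [Csqrt] then turns
     [Rabs (Im z)] back into [Im z]. *)
  assert (Hab : 2 * (sqrt ((r + Re z) / 2) * sqrt ((r - Re z) / 2)) = Rabs (Im z)).
  { rewrite <- sqrt_mult by lra.
    replace ((r + Re z) / 2 * ((r - Re z) / 2)) with (Rsqr (Im z / 2)).
    - rewrite sqrt_Rsqr_abs; unfold Rdiv; rewrite Rabs_mult, (Rabs_right (/ 2)); lra.
    - unfold Rsqr; transitivity ((r * r - Re z * Re z) / 4); [rewrite Hn|]; field. }
  unfold Csqrt; fold r; apply Cplx_eq; cbn [Re Im Cmul].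
  - destruct (Rle_dec 0 (Im z)); nra.
  - destruct (Rle_dec 0 (Im z)).
    + rewrite Rabs_right in Hab by lra; lra.
    + rewrite Rabs_left in Hab by lra; lra.
Qed.

Lemma Re_Csqrt_pos (z : Cplx) : 0 < Re z -> 0 < Re (Csqrt z).
Proof.
  intros H; pose proof (Cnorm_ge_0 z); simpl; apply sqrt_lt_R0; lra.
Qed.

Lemma Csqrt_conj (z : Cplx) : 0 < Re z -> Csqrt (Cconj z) = Cconj (Csqrt z).
Proof.
  intros H; unfold Csqrt; rewrite Cnorm_conj.
  apply Cplx_eq; cbn [Re Im Cconj]; [reflexivity|].
  destruct (Rle_dec 0 (Im z)) as [H1|H1], (Rle_dec 0 (- Im z)) as [H2|H2]; try lra.
  (* Both sign tests succeed only for [Im z = 0]; as [Re z > 0], the imaginary part of the root is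
     then 0 and its sign is harmless. *)
  assert (Hr : Cnorm z = Re z) by (apply Cnorm_unique; nra).
  rewrite Hr; replace ((Re z - Re z) / 2) with 0 by field; rewrite sqrt_0; ring.
Qed.

Lemma half_q_opp (q : R) : half_q (- q) = (- half_q q)%C.
Proof. apply Cplx_eq; simpl; field. Qed.

Lemma Delta_plus_opp_q (q : R) (x : Cplx) : Delta_plus (- q) x = Delta_plus q x.
Proof. unfold Delta_plus; rewrite half_q_opp; f_equal; ring. Qed.

(** [Delta_plus] is even in [q]; [- q] is chosen to agree with the off-diagonal sign in
    [A_minus]. *)
Lemma Delta_minus_eq (q : R) (x : Cplx) : Delta_minus q x = Delta_plus (- q) (/ x).
Proof. rewrite Delta_plus_opp_q; reflexivity. Qed.

Lemma Delta_plus_opp (q : R) (x : Cplx) : Delta_plus q (- x) = Delta_plus q x.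
Proof. unfold Delta_plus; f_equal; ring. Qed.

Section Delta.
Variable q : R.
Hypothesis hq : Rabs (q / 2) < 1.
Let Q := half_q q.

Lemma Cnorm_Qx_sqr (x : Cplx) : on_circle x -> Cnorm (Q * Q * (x * x)) = (q / 2) * (q / 2).
Proof.
  intros Hx; rewrite !Cnorm_mul, Hx; unfold Q, half_q; rewrite Cnorm_RtoC.
  rewrite !Rmult_1_r, <- Rabs_mult; apply Rabs_right; nra.
Qed.

Lemma pnorm_Qx_sqr : pnorm [0%C; 0%C; (- (Q * Q))%C] = (q / 2) * (q / 2).
Proof.
  cbn [pnorm]; rewrite Cnorm_0, Cnorm_opp, Cnorm_mul; unfold Q, half_q; rewrite Cnorm_RtoC.
  rewrite <- Rabs_mult, Rabs_right by nra; ring.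
Qed.

Lemma half_sqr_lt_1 : 0 <= (q / 2) * (q / 2) < 1.
Proof. apply Rabs_def2 in hq; nra. Qed.

Lemma Delta_plus_sqr (x : Cplx) : (Delta_plus q x * Delta_plus q x)%C = (1 + Q * Q * (x * x))%C.
Proof. apply Csqrt_sqr. Qed.

Lemma Re_Delta_sqr_pos (x : Cplx) : on_circle x -> 0 < Re (1 + Q * Q * (x * x))%C.
Proof.
  intros Hx; pose proof (Cnorm_Qx_sqr x Hx) as H; pose proof half_sqr_lt_1.
  pose proof (Re_le_Cnorm (Q * Q * (x * x))) as H1.
  pose proof (Rle_abs (- Re (Q * Q * (x * x))%C)) as H2; rewrite Rabs_Ropp in H2.
  change (0 < 1 + Re (Q * Q * (x * x))%C); lra.
Qed.

Lemma Re_Delta_plus_pos (x : Cplx) : on_circle x -> 0 < Re (Delta_plus q x).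
Proof. intros Hx; apply Re_Csqrt_pos, Re_Delta_sqr_pos, Hx. Qed.

Lemma Delta_plus_neq_0 (x : Cplx) : on_circle x -> Delta_plus q x <> 0%C.
Proof. intros Hx H; pose proof (Re_Delta_plus_pos x Hx) as H1; rewrite H in H1; simpl in H1; lra. Qed.

Lemma Delta_plus_conj (x : Cplx) :
  on_circle x -> Delta_plus q (Cconj x) = Cconj (Delta_plus q x).
Proof.
  intros Hx; unfold Delta_plus; rewrite <- Csqrt_conj by (apply Re_Delta_sqr_pos, Hx).
  f_equal; cplx.
Qed.

Lemma ldiff_Delta_plus (x : Cplx) :
  on_circle x -> ldiff (Delta_plus q) x (Q * Q * (x * x) * / Delta_plus q x).
Proof.
  intros Hx.
  eapply ldiff_ext; [exact Hx|reflexivity| |].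
  2: { apply (ldiff_sqrt (fun y => 1 + Q * Q * (y * y))%C).
       - exact Re_Delta_plus_pos.
       - intros y _; apply Delta_plus_sqr.
       - exact Hx.
       - apply ldiff_add; [apply ldiff_const|].
         apply ldiff_mul; [exact Hx|apply ldiff_const|].
         apply ldiff_mul; [exact Hx|apply ldiff_id, Hx|apply ldiff_id, Hx]. }
  cbv beta.
  assert (H2 : (1 + 1)%C <> 0%C) by (intros H; apply (f_equal Re) in H; simpl in H; lra).
  replace (Delta_plus q x + Delta_plus q x)%C with ((1 + 1) * Delta_plus q x)%C by ring.
  field; split; [apply Delta_plus_neq_0, Hx|exact H2].
Qed.

Lemma ldiff_Delta_plus_inv_pow (n : nat) (x : Cplx) : on_circle x ->
  ldiff (fun y => Cpow (/ Delta_plus q y) n) x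
    (- (RtoC (INR n) * (Q * Q * (x * x) * / (Delta_plus q x * Delta_plus q x)) *
        Cpow (/ Delta_plus q x) n)).
Proof.
  intros Hx; induction n as [|n IH].
  - apply (ldiff_ext (fun _ => 1%C) _ _ 0%C); [exact Hx|reflexivity| |apply ldiff_const].
    simpl INR; change (RtoC 0) with 0%C; ring.
  - cbn [Cpow]; eapply ldiff_ext; [exact Hx|reflexivity| |].
    2: { apply ldiff_mul; [exact Hx| |exact IH].
         apply ldiff_inv; [exact Delta_plus_neq_0|exact Hx|apply ldiff_Delta_plus, Hx]. }
    rewrite S_INR; replace (RtoC (INR n + 1)) with (RtoC (INR n) + 1)%C by cplx.
    field; apply Delta_plus_neq_0, Hx.
Qed.

(* [1 - Delta] is the fixed point of the contraction [p |-> (X + p^2) / 2], [X = - Q^2 x^2]. *)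
Lemma Pp_Delta_plus : Pp (Delta_plus q).
Proof.
  pose (rho := (q / 2) * (q / 2)).
  pose (X := [0%C; 0%C; (- (Q * Q))%C]).
  pose (h := RtoC (/ 2)).
  pose (p := fix p k := match k with O => [] | S k => pscale h (padd X (pmul (p k) (p k))) end).
  pose proof half_sqr_lt_1 as Hrho; fold rho in Hrho.
  assert (Hh : Cnorm h = / 2) by (unfold h; rewrite Cnorm_RtoC, Rabs_right; lra).
  assert (HX : pnorm X = rho) by apply pnorm_Qx_sqr.
  (* The ball of radius [rho] is invariant because [(rho + rho^2) / 2 <= rho]; on it the iteration
     contracts with ratio [rho]. *)
  assert (Hp : forall k, pnorm (p k) <= rho).
  { induction k as [|k IH]; [simpl; lra|].
    change (p (S k)) with (pscale h (padd X (pmul (p k) (p k)))); rewrite pnorm_pscale, Hh.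
    pose proof (pdist_padd X [] (pmul (p k) (p k)) []) as H1; simpl (padd [] []) in H1.
    rewrite !pdist_nil_r, HX in H1.
    pose proof (pnorm_pmul (p k) (p k)); pose proof (pnorm_ge_0 (p k)); nra. }
  assert (H1 : Pp (fun x => 1 - Delta_plus q x)%C).
  { apply (Pp_geometric _ p rho 1); [exact Hrho|lra| |].
    - induction k as [|k IH].
      + simpl (rho ^ 0); replace (p O) with (@nil Cplx) by reflexivity.
        rewrite pdist_nil_r; pose proof (Hp 1%nat); lra.
      + set (pk := p (S k)) in *.
        change (p (S (S k))) with (pscale h (padd X (pmul pk pk))).
        unfold pk at 3; change (p (S k)) with (pscale h (padd X (pmul (p k) (p k)))).
        rewrite pdist_pscale, Hh.
        pose proof (pdist_padd X X (pmul pk pk) (pmul (p k) (p k))) as H1.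
        rewrite pdist_refl in H1.
        pose proof (pdist_triangle (pmul pk pk) (pmul pk (p k)) (pmul (p k) (p k))).
        pose proof (pdist_pmul_l pk pk (p k)); pose proof (pdist_pmul_r pk (p k) (p k)).
        pose proof (Hp k); pose proof (Hp (S k)) as H6; fold pk in H6.
        pose proof (pdist_ge_0 pk (p k)); simpl (rho ^ S k).
        pose proof (pow_le rho k ltac:(lra)); nra.
    - intros k x Hx.
      set (z := (1 - Delta_plus q x)%C).
      assert (Hz : z = (h * (- (Q * Q * (x * x)) + z * z))%C).
      { unfold z.
        replace (- (Q * Q * (x * x)) + (1 - Delta_plus q x) * (1 - Delta_plus q x))%C with
          (1 + 1 - Delta_plus q x - Delta_plus q x +
           (Delta_plus q x * Delta_plus q x - (1 + Q * Q * (x * x))))%C by ring.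
        rewrite Delta_plus_sqr; unfold h; apply Cplx_eq; simpl; field. }
      (* From [(1 - Delta) (1 + Delta) = - Q^2 x^2] and [|1 + Delta| >= 1], so the fixed point lies
         in the same ball. *)
      assert (Hzn : Cnorm z <= rho).
      { assert (Hm : Cnorm (z * (1 + Delta_plus q x)) = rho).
        { replace (z * (1 + Delta_plus q x))%C with (1 - Delta_plus q x * Delta_plus q x)%C
            by (unfold z; ring).
          rewrite Delta_plus_sqr; unfold rho; rewrite <- (Cnorm_Qx_sqr x Hx), <- Cnorm_opp.
          f_equal; ring. }
        rewrite Cnorm_mul in Hm.
        pose proof (Re_le_Cnorm (1 + Delta_plus q x)) as H2.
        change (Re (1 + Delta_plus q x)%C) with (1 + Re (Delta_plus q x)) in H2.
        pose proof (Re_Delta_plus_pos x Hx); pose proof (Cnorm_ge_0 z).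
        rewrite Rabs_right in H2 by lra; nra. }
      induction k as [|k IH].
      + simpl; replace (z - 0)%C with z by ring; lra.
      + rewrite Hz; change (p (S k)) with (pscale h (padd X (pmul (p k) (p k)))).
        rewrite peval_pscale, peval_padd, peval_pmul.
        replace (peval X x) with (- (Q * Q * (x * x)))%C by (simpl peval; ring).
        match goal with |- Cnorm ?e <= _ =>
          replace e with (h * ((z - peval (p k) x) * (z + peval (p k) x)))%C by ring end.
        rewrite !Cnorm_mul, Hh.
        pose proof (Cnorm_add z (peval (p k) x)); pose proof (Cnorm_peval (p k) x Hx).
        pose proof (Hp k); pose proof (Cnorm_ge_0 (z - peval (p k) x)).
        pose proof (Cnorm_ge_0 (z + peval (p k) x)).
        simpl (rho ^ S k); nra. }
  apply (Pp_ext (fun x => 1 - (1 - Delta_plus q x))%C); [intros; ring|].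
  apply Pp_sub; [apply Pp_const|exact H1].
Qed.

(** Only [1 / Delta^2] is inverted, by the geometric series of [- Q^2 x^2]; then
    [1 / Delta = Delta * (1 / Delta^2)]. *)
Lemma Pp_Delta_plus_inv : Pp (fun x => / Delta_plus q x)%C.
Proof.
  pose (rho := (q / 2) * (q / 2)).
  pose (X := [0%C; 0%C; (- (Q * Q))%C]).
  pose (p := fix p k := match k with O => [] | S k => padd [1%C] (pmul X (p k)) end).
  pose proof half_sqr_lt_1 as Hrho; fold rho in Hrho.
  assert (HX : pnorm X = rho) by apply pnorm_Qx_sqr.
  pose (D := fun x => (Delta_plus q x * Delta_plus q x)%C).
  assert (HD : forall x, on_circle x -> D x <> 0%C)
    by (intros; apply Cmul_neq_0; apply Delta_plus_neq_0; assumption).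
  assert (H1 : Pp (fun x => / D x)%C).
  (* The constant bounds the initial error [|1 / D|], since [|D| >= 1 - rho] on the circle; each
     iteration multiplies the error by [- Q^2 x^2]. *)
  { apply (Pp_geometric _ p rho (1 / (1 - rho))); [exact Hrho| | |].
    - apply Rlt_le, Rdiv_lt_0_compat; lra.
    - assert (Hk : forall k, pdist (p (S k)) (p k) <= rho ^ k).
      { induction k as [|k IH].
        - replace (p O) with (@nil Cplx) by reflexivity; rewrite pdist_nil_r.
          simpl p; simpl pnorm; rewrite ?Cnorm_0.
          match goal with |- context [Cnorm ?z] => replace z with 1%C by ring end.
          rewrite Cnorm_1; simpl; lra.
        - change (p (S (S k))) with (padd [1%C] (pmul X (p (S k)))).
          change (p (S k)) with (padd [1%C] (pmul X (p k))) at 2.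
          eapply Rle_trans; [apply pdist_padd|]; rewrite pdist_refl.
          pose proof (pdist_pmul_l X (p (S k)) (p k)) as H2; rewrite HX in H2.
          simpl (rho ^ S k); nra. }
      intros k; eapply Rle_trans; [apply Hk|].
      pose proof (pow_le rho k ltac:(lra)).
      assert (1 <= 1 / (1 - rho)); [|nra].
      apply Rmult_le_reg_r with (1 - rho); [lra|].
      unfold Rdiv; rewrite Rmult_assoc, Rinv_l; lra.
    - intros k x Hx; induction k as [|k IH].
      + simpl; replace (/ D x - 0)%C with (/ D x)%C by ring.
        rewrite Cnorm_inv, Rmult_1_r by auto; unfold Rdiv; rewrite Rmult_1_l.
        apply Rinv_le_contravar; [lra|].
        unfold D; rewrite Delta_plus_sqr.
        pose proof (Cnorm_sub (1 + Q * Q * (x * x)) (Q * Q * (x * x))) as H2.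
        replace (1 + Q * Q * (x * x) - Q * Q * (x * x))%C with 1%C in H2 by ring.
        rewrite Cnorm_1, Cnorm_Qx_sqr in H2 by exact Hx; fold rho in H2; lra.
      + change (p (S k)) with (padd [1%C] (pmul X (p k))).
        rewrite peval_padd, peval_pmul.
        match goal with |- Cnorm ?e <= _ =>
          replace e with (- (Q * Q * (x * x)) * (/ D x - peval (p k) x))%C end.
        * rewrite Cnorm_mul, Cnorm_opp, Cnorm_Qx_sqr by exact Hx; fold rho.
          replace (1 / (1 - rho) * rho ^ S k) with (rho * (1 / (1 - rho) * rho ^ k))
            by (simpl; ring).
          apply Rmult_le_compat_l; lra.
        * simpl peval.
          replace (- (Q * Q * (x * x)))%C with (1 - D x)%C
            by (unfold D; rewrite Delta_plus_sqr; ring).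
          replace (- (Q * Q))%C with ((1 - D x) * / (x * x))%C.
          -- field; auto using circle_neq_0.
          -- unfold D; rewrite Delta_plus_sqr; field; auto using circle_neq_0. }
  apply (Pp_ext (fun x => Delta_plus q x * / D x)%C).
  - intros x Hx; unfold D; field; apply Delta_plus_neq_0, Hx.
  - apply Pp_mul; [apply Pp_Delta_plus|exact H1].
Qed.

End Delta.

(** * Dressed loops *)

(** Replaces the inverse on matrices of determinant 1: being linear in the entries, it preserves
    nonnegative frequencies without any division. *)
Definition Madj (A : M2) : M2 := mkM2 (m22 A) (- m12 A)%C (- m21 A)%C (m11 A).
Definition sigma1 : M2 := mkM2 0%C 1%C 1%C 0%C.

Lemma M2_eq (A B : M2) :
  m11 A = m11 B -> m12 A = m12 B -> m21 A = m21 B -> m22 A = m22 B -> A = B.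
Proof. destruct A, B; simpl; intros -> -> -> ->; reflexivity. Qed.

Ltac mred := cbn [m11 m12 m21 m22 Mmul Madd Mscale Madj Mid Mdiag sigma1 Mdet].
Ltac mring := intros; apply M2_eq; mred; ring.

Lemma Mmul_assoc (A B C : M2) : Mmul (Mmul A B) C = Mmul A (Mmul B C).
Proof. mring. Qed.
Lemma Mmul_1_l (A : M2) : Mmul Mid A = A.
Proof. mring. Qed.
Lemma Mmul_1_r (A : M2) : Mmul A Mid = A.
Proof. mring. Qed.
Lemma Mmul_scale_l (c : Cplx) (A B : M2) : Mmul (Mscale c A) B = Mscale c (Mmul A B).
Proof. mring. Qed.
Lemma Mmul_scale_r (c : Cplx) (A B : M2) : Mmul A (Mscale c B) = Mscale c (Mmul A B).
Proof. mring. Qed.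
Lemma Mscale_scale (c d : Cplx) (A : M2) : Mscale c (Mscale d A) = Mscale (c * d) A.
Proof. mring. Qed.
Lemma Mmul_add_r (A B C : M2) : Mmul A (Madd B C) = Madd (Mmul A B) (Mmul A C).
Proof. mring. Qed.
Lemma Madj_mul (A B : M2) : Madj (Mmul A B) = Mmul (Madj B) (Madj A).
Proof. mring. Qed.
Lemma Mdet_mul (A B : M2) : Mdet (Mmul A B) = (Mdet A * Mdet B)%C.
Proof. mred; unfold Mdet; mred; ring. Qed.

Lemma Madj_mul_l (A : M2) : Mdet A = 1%C -> Mmul (Madj A) A = Mid.
Proof. unfold Mdet; intros H; apply M2_eq; mred; rewrite <- ?H; ring. Qed.
Lemma Madj_mul_r (A : M2) : Mdet A = 1%C -> Mmul A (Madj A) = Mid.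
Proof. unfold Mdet; intros H; apply M2_eq; mred; rewrite <- ?H; ring. Qed.

Lemma Minv_det_1 (A : M2) : Mdet A = 1%C -> Minv A = Madj A.
Proof.
  intros H; unfold Minv; rewrite H.
  assert (H1 : (/ 1)%C = 1%C) by (field; exact C1_neq_0).
  rewrite H1; mring.
Qed.

Lemma Mpow_succ_r (A : M2) (n : nat) : Mpow A (S n) = Mmul (Mpow A n) A.
Proof.
  induction n as [|n IH]; [simpl Mpow; rewrite Mmul_1_l, Mmul_1_r; reflexivity|].
  change (Mpow A (S (S n))) with (Mmul A (Mpow A (S n))).
  rewrite IH at 1; rewrite <- Mmul_assoc; reflexivity.
Qed.

Lemma Mpow_scale (c : Cplx) (A : M2) (n : nat) :
  Mpow (Mscale c A) n = Mscale (Cpow c n) (Mpow A n).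
Proof.
  induction n as [|n IH]; cbn [Mpow Cpow]; [mring|].
  rewrite IH, Mmul_scale_l, Mmul_scale_r, Mscale_scale; reflexivity.
Qed.

Lemma Mpow_mul_inv (A B : M2) (n : nat) :
  Mmul A B = Mid -> Mmul (Mpow A n) (Mpow B n) = Mid.
Proof.
  intros H; induction n as [|n IH]; [apply Mmul_1_l|].
  rewrite (Mpow_succ_r B); cbn [Mpow].
  rewrite Mmul_assoc, <- (Mmul_assoc (Mpow A n)), IH, Mmul_1_l; exact H.
Qed.

Lemma Mdet_pow (A : M2) (n : nat) : Mdet A = 1%C -> Mdet (Mpow A n) = 1%C.
Proof.
  intros H; induction n as [|n IH]; cbn [Mpow].
  - unfold Mdet; mred; ring.
  - rewrite Mdet_mul, H, IH; ring.
Qed.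

Definition MPp (F : Cplx -> M2) : Prop :=
  Pp (fun x => m11 (F x)) /\ Pp (fun x => m12 (F x)) /\
  Pp (fun x => m21 (F x)) /\ Pp (fun x => m22 (F x)).

Lemma MPp_const (A : M2) : MPp (fun _ => A).
Proof. repeat split; apply Pp_const. Qed.

Lemma MPp_mul (F G : Cplx -> M2) : MPp F -> MPp G -> MPp (fun x => Mmul (F x) (G x)).
Proof.
  intros (H1 & H2 & H3 & H4) (H5 & H6 & H7 & H8).
  repeat split; mred; apply Pp_add; apply Pp_mul; assumption.
Qed.

Lemma MPp_add (F G : Cplx -> M2) : MPp F -> MPp G -> MPp (fun x => Madd (F x) (G x)).
Proof.
  intros (H1 & H2 & H3 & H4) (H5 & H6 & H7 & H8).
  repeat split; mred; apply Pp_add; assumption.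
Qed.

Lemma MPp_scale (c : Cplx -> Cplx) (F : Cplx -> M2) :
  Pp c -> MPp F -> MPp (fun x => Mscale (c x) (F x)).
Proof. intros Hc (H1 & H2 & H3 & H4); repeat split; mred; apply Pp_mul; assumption. Qed.

Lemma MPp_adj (F : Cplx -> M2) : MPp F -> MPp (fun x => Madj (F x)).
Proof. intros (H1 & H2 & H3 & H4); repeat split; mred; try apply Pp_opp; assumption. Qed.

Lemma MPp_pow (F : Cplx -> M2) (n : nat) : MPp F -> MPp (fun x => Mpow (F x) n).
Proof.
  intros HF; induction n as [|n IH]; cbn [Mpow]; [apply MPp_const|].
  apply MPp_mul; assumption.
Qed.

Definition Mldiff (F : Cplx -> M2) (x : Cplx) (E : M2) : Prop :=
  ldiff (fun y => m11 (F y)) x (m11 E) /\ ldiff (fun y => m12 (F y)) x (m12 E) /\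
  ldiff (fun y => m21 (F y)) x (m21 E) /\ ldiff (fun y => m22 (F y)) x (m22 E).

Lemma Mldiff_ext (F G : Cplx -> M2) (x : Cplx) (E E' : M2) :
  on_circle x -> (forall y, on_circle y -> F y = G y) -> E = E' -> Mldiff F x E -> Mldiff G x E'.
Proof.
  intros Hx H <- (H1 & H2 & H3 & H4); repeat split;
    (eapply ldiff_ext; [exact Hx| |reflexivity|eassumption]);
    intros y Hy; cbv beta; rewrite H by exact Hy; reflexivity.
Qed.

Lemma Mldiff_const (A : M2) (x : Cplx) : Mldiff (fun _ => A) x (Mscale 0 A).
Proof.
  repeat split; mred;
    match goal with |- ldiff _ _ (0 * ?a)%C => replace (0 * a)%C with 0%C by ring end;
    apply ldiff_const.
Qed.

Lemma Mldiff_mul (F G : Cplx -> M2) (x : Cplx) (E E' : M2) :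
  on_circle x -> Mldiff F x E -> Mldiff G x E' ->
  Mldiff (fun y => Mmul (F y) (G y)) x (Madd (Mmul E (G x)) (Mmul (F x) E')).
Proof.
  intros Hx (H1 & H2 & H3 & H4) (H5 & H6 & H7 & H8).
  repeat split; mred;
    (eapply ldiff_ext; [exact Hx|reflexivity| |
       apply ldiff_add; apply ldiff_mul; eassumption]); cbv beta; ring.
Qed.

Lemma Mldiff_scale (c : Cplx -> Cplx) (F : Cplx -> M2) (x c' : Cplx) (E : M2) :
  on_circle x -> ldiff c x c' -> Mldiff F x E ->
  Mldiff (fun y => Mscale (c y) (F y)) x (Madd (Mscale c' (F x)) (Mscale (c x) E)).
Proof.
  intros Hx Hc (H1 & H2 & H3 & H4); repeat split; mred;
    apply (ldiff_mul c); assumption.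
Qed.

Lemma Mldiff_comp_inv (F : Cplx -> M2) (x : Cplx) (E : M2) :
  on_circle x -> Mldiff F (/ x) E -> Mldiff (fun y => F (/ y)%C) x (Mscale (- (1)) E).
Proof.
  intros Hx (H1 & H2 & H3 & H4); repeat split; mred;
    match goal with |- ldiff _ _ (_ * ?a)%C => replace (- (1) * a)%C with (- a)%C by ring end.
  - apply (ldiff_comp_inv (fun y => m11 (F y))); assumption.
  - apply (ldiff_comp_inv (fun y => m12 (F y))); assumption.
  - apply (ldiff_comp_inv (fun y => m21 (F y))); assumption.
  - apply (ldiff_comp_inv (fun y => m22 (F y))); assumption.
Qed.

Lemma Mldiff_unique (F : Cplx -> M2) (x : Cplx) (E E' : M2) :
  on_circle x -> Mldiff F x E -> Mldiff F x E' -> E = E'.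
Proof.
  intros Hx (H1 & H2 & H3 & H4) (H5 & H6 & H7 & H8).
  apply M2_eq; eapply ldiff_unique; eassumption.
Qed.

(** * The matrices [A_plus] and [A_minus] *)

Lemma A_minus_eq (q : R) (x : Cplx) : A_minus q x = A_plus (- q) (/ x).
Proof.
  unfold A_minus, A_plus; rewrite Delta_minus_eq, half_q_opp; cbv zeta.
  f_equal; f_equal; ring.
Qed.

(** Exhibits [A_plus ^ n] as [Delta_plus ^ (-n) x^n] times a polynomial in [1/x]; this is where the
    upper bound [n] on frequencies comes from. *)
Lemma A_plus_scaled (q : R) (x : Cplx) : on_circle x ->
  A_plus q x = Mscale (/ Delta_plus q x * x)
    (mkM2 (/ x) (Ci * half_q q) (Ci * half_q q) (/ x))%C.
Proof.
  intros Hx; unfold A_plus; apply M2_eq; mred; try ring.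
  all: transitivity (/ Delta_plus q x * (x * / x))%C; [|ring];
    replace (x * / x)%C with 1%C by (field; apply circle_neq_0, Hx); reflexivity.
Qed.

Lemma A_plus_inv (q : R) (x : Cplx) : Rabs (q / 2) < 1 -> on_circle x ->
  Mmul (A_plus q x) (A_plus (- q) x) = Mid.
Proof.
  intros hq Hx; pose proof (Delta_plus_neq_0 q hq x Hx) as Hd.
  assert (H : (/ (Delta_plus q x * Delta_plus q x) * (1 + half_q q * half_q q * (x * x)))%C = 1%C)
    by (rewrite <- Delta_plus_sqr; field; exact Hd).
  unfold A_plus; rewrite Delta_plus_opp_q, half_q_opp; cbv zeta.
  apply M2_eq; mred; try ring.
  all: transitivity (/ Delta_plus q x * / Delta_plus q x *
      (1 - (Ci * Ci) * half_q q * half_q q * (x * x)))%C; [ring|].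
  all: rewrite Ci_sqr; etransitivity; [|exact H]; field; exact Hd.
Qed.

Lemma Madj_A_plus (q : R) (x : Cplx) : Madj (A_plus q x) = A_plus (- q) x.
Proof.
  unfold A_plus; rewrite Delta_plus_opp_q, half_q_opp; cbv zeta; mring.
Qed.

Lemma Mdet_A_plus (q : R) (x : Cplx) : Rabs (q / 2) < 1 -> on_circle x ->
  Mdet (A_plus q x) = 1%C.
Proof.
  intros hq Hx; pose proof (A_plus_inv q x hq Hx) as H; rewrite <- Madj_A_plus in H.
  apply (f_equal m11) in H; etransitivity; [|exact H].
  unfold Mdet; mred; ring.
Qed.

Lemma MPp_A_plus (q : R) : Rabs (q / 2) < 1 -> MPp (A_plus q).
Proof.
  intros hq; unfold A_plus; cbv zeta.
  apply (MPp_scale (fun x => / Delta_plus q x)%C); [apply Pp_Delta_plus_inv, hq|].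
  assert (H : Pp (fun x => Ci * (half_q q * x))%C)
    by (apply Pp_mul; [|apply Pp_mul]; auto using Pp_const, Pp_id).
  repeat split; mred; auto using Pp_const.
Qed.

(** Formally [A_plus = exp (i theta sigma1)] with [tan theta = Q x], and [lambda d/dlambda] of
    [theta] is [Q x / (1 + Q^2 x^2)]. As all these matrices commute with [sigma1], an [n]-th power
    only multiplies the factor by [n]. *)
Lemma Mldiff_A_plus (q : R) (x : Cplx) : Rabs (q / 2) < 1 -> on_circle x ->
  Mldiff (A_plus q) x
    (Mscale (Ci * half_q q * x * / (Delta_plus q x * Delta_plus q x)) (Mmul (A_plus q x) sigma1)).
Proof.
  intros hq Hx; pose proof (Delta_plus_neq_0 q hq x Hx) as Hd.
  assert (Hinv : ldiff (fun y => / Delta_plus q y)%C x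
    (- (half_q q * half_q q * (x * x) * / Delta_plus q x * / (Delta_plus q x * Delta_plus q x)))).
  { apply ldiff_inv; [apply Delta_plus_neq_0, hq|exact Hx|apply ldiff_Delta_plus; assumption]. }
  assert (Hlin : ldiff (fun y => Ci * (half_q q * y))%C x (Ci * (half_q q * x))).
  { eapply ldiff_ext; [exact Hx|reflexivity| |].
    2: apply ldiff_mul; [exact Hx|apply ldiff_const|].
    2: apply ldiff_mul; [exact Hx|apply ldiff_const|apply ldiff_id, Hx].
    cbv beta; ring. }
  assert (Hdiag : ldiff (fun y => / Delta_plus q y * 1)%C x
    (Ci * half_q q * x * / (Delta_plus q x * Delta_plus q x) *
      (/ Delta_plus q x * (Ci * (half_q q * x))))).
  { eapply ldiff_ext; [exact Hx|reflexivity| |].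
    2: apply ldiff_mul; [exact Hx|exact Hinv|apply ldiff_const].
    cbv beta; transitivity ((Ci * Ci) * half_q q * half_q q * (x * x) * / Delta_plus q x *
      / (Delta_plus q x * Delta_plus q x))%C; [rewrite Ci_sqr|]; ring. }
  assert (Hoff : ldiff (fun y => / Delta_plus q y * (Ci * (half_q q * y)))%C x
    (Ci * half_q q * x * / (Delta_plus q x * Delta_plus q x) * (/ Delta_plus q x))).
  { eapply ldiff_ext; [exact Hx|reflexivity| |].
    2: apply ldiff_mul; [exact Hx|exact Hinv|exact Hlin].
    cbv beta.
    transitivity (Ci * half_q q * x * / (Delta_plus q x * Delta_plus q x) * / Delta_plus q x *
      (Delta_plus q x * Delta_plus q x - half_q q * half_q q * (x * x)))%C; [field; exact Hd|].
    rewrite Delta_plus_sqr; ring. }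
  unfold A_plus; cbv zeta; repeat split; mred.
  - eapply ldiff_ext; [exact Hx|reflexivity| |exact Hdiag]; ring.
  - eapply ldiff_ext; [exact Hx|reflexivity| |exact Hoff]; ring.
  - eapply ldiff_ext; [exact Hx|reflexivity| |exact Hoff]; ring.
  - eapply ldiff_ext; [exact Hx|reflexivity| |exact Hdiag]; ring.
Qed.

Lemma A_plus_sigma1 (q : R) (x : Cplx) :
  Mmul (A_plus q x) sigma1 = Mmul sigma1 (A_plus q x).
Proof. unfold A_plus; cbv zeta; mring. Qed.

Lemma Mldiff_A_plus_pow (q : R) (n : nat) (x : Cplx) : Rabs (q / 2) < 1 -> on_circle x ->
  Mldiff (fun y => Mpow (A_plus q y) n) x
    (Mscale (RtoC (INR n) * (Ci * half_q q * x * / (Delta_plus q x * Delta_plus q x)))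
      (Mmul (Mpow (A_plus q x) n) sigma1)).
Proof.
  intros hq Hx; induction n as [|n IH]; cbn [Mpow].
  - eapply Mldiff_ext; [exact Hx|reflexivity| |apply Mldiff_const].
    change (RtoC (INR 0)) with 0%C; mring.
  - eapply Mldiff_ext; [exact Hx|reflexivity| |apply Mldiff_mul; [exact Hx| |exact IH]].
    2: apply Mldiff_A_plus; assumption.
    assert (Hc : Mmul (Mmul (A_plus q x) sigma1) (Mpow (A_plus q x) n) =
                 Mmul (A_plus q x) (Mmul (Mpow (A_plus q x) n) sigma1)).
    { rewrite Mmul_assoc; f_equal.
      clear; induction n as [|n IH]; cbn [Mpow]; [mring|].
      rewrite <- Mmul_assoc, <- A_plus_sigma1, Mmul_assoc, IH, Mmul_assoc; reflexivity. }
    cbv beta; rewrite Mmul_scale_l, Mmul_scale_r, Hc, Mmul_assoc, S_INR.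
    replace (RtoC (INR n + 1)) with (RtoC (INR n) + 1)%C by cplx.
    generalize (Mmul (A_plus q x) (Mmul (Mpow (A_plus q x) n) sigma1)); mring.
Qed.

Lemma Pp_liouville_ldiff (f g : Cplx -> Cplx) (d : nat) :
  Pp f -> Pp g -> (forall x, on_circle x -> f x = Cpow x d * g (/ x))%C ->
  exists r, Pp r /\ forall x, on_circle x -> ldiff f x (x * r x).
Proof.
  intros Hf Hg H; destruct (Pp_liouville f g d Hf Hg H) as [t Ht].
  destruct (ldiff_peval (map t (seq 0 (S d)))) as [r Hr].
  exists (peval r); split; [apply Pp_peval|]; intros x Hx.
  eapply ldiff_ext; [exact Hx| |reflexivity|apply Hr, Hx].
  intros y Hy; symmetry; apply Ht, Hy.
Qed.

(* Multiplying [W] by [Delta_plus ^ n] clears the square roots: the result has frequencies both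
   [>= 0] and [<= n], so it is a polynomial. This makes [W] differentiable, with a derivative
   whose only new denominator is [Delta_plus ^ 2]. *)
Lemma dressed_ldiff (q : R) (Dl Ds : M2) (m n : nat) (V W : Cplx -> M2) :
  Rabs (q / 2) < 1 -> Mdet Dl = 1%C -> MPp V -> MPp W ->
  (forall x, on_circle x -> Mdet (W x) = 1%C) ->
  (forall x, on_circle x ->
     Mmul (Mmul Dl (Mpow (A_plus (- q) (/ x)) m)) (W x) =
     Mmul (Mmul Ds (Mpow (A_plus q x) n)) (V (/ x)%C)) ->
  exists E H : Cplx -> M2, MPp H /\ forall x, on_circle x ->
    Mldiff (fun y => Mmul (Mmul Dl (Mpow (A_plus (- q) (/ y)) m)) (W y)) x (E x) /\
    H x = Mscale (x * (Delta_plus q x * Delta_plus q x *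
                       (Delta_plus q (/ x) * Delta_plus q (/ x))))
            (Mmul (Minv (Mmul (Mmul Dl (Mpow (A_plus (- q) (/ x)) m)) (W x))) (E x)).
Proof.
  intros hq HDl HV HW HdetW Heq.
  assert (hq' : Rabs (- q / 2) < 1).
  { replace (- q / 2) with (- (q / 2)) by field; rewrite Rabs_Ropp; exact hq. }
  pose (T := fun x => Mscale (Cpow (Delta_plus q x) n) (W x)).
  (* The hypothesis solved for [W], written in [y = 1/x] after [Delta_plus ^ (-n)] and [x^n] have
     been taken out of [A_plus q x ^ n]; [A_plus q y] inverts [A_plus (- q) y]. *)
  pose (Tinv := fun y => Mmul (Mmul (Mpow (A_plus q y) m) (Mmul (Madj Dl) Ds))
    (Mmul (Mpow (mkM2 y (Ci * half_q q) (Ci * half_q q) y)%C n) (V y))).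
  assert (HT : MPp T) by (apply MPp_scale; [apply Pp_pow, Pp_Delta_plus, hq|exact HW]).
  assert (HTinv : MPp Tinv).
  { apply MPp_mul; apply MPp_mul; auto using MPp_const, MPp_pow, MPp_A_plus.
    apply MPp_pow; repeat split; mred; auto using Pp_const, Pp_id. }
  assert (HTT : forall x, on_circle x -> T x = Mscale (Cpow x n) (Tinv (/ x)%C)).
  { intros x Hx.
    assert (HWx : W x = Mmul (Mmul (Mpow (A_plus q (/ x)) m) (Madj Dl))
                          (Mmul (Mmul Ds (Mpow (A_plus q x) n)) (V (/ x)%C))).
    { rewrite <- Heq, <- !Mmul_assoc, (Mmul_assoc _ (Madj Dl)), Madj_mul_l, Mmul_1_r by assumption.
      rewrite Mpow_mul_inv, Mmul_1_l; [reflexivity|].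
      apply A_plus_inv; [exact hq|apply circle_inv, Hx]. }
    unfold T, Tinv; rewrite HWx, (A_plus_scaled q x), Mpow_scale by exact Hx.
    rewrite Cpow_mul_base.
    replace (Cpow x n) with
      (Cpow (Delta_plus q x) n * (Cpow (/ Delta_plus q x) n * Cpow x n))%C at 2.
    - rewrite Mmul_scale_r, Mmul_scale_l, Mmul_scale_r, Mscale_scale, !Mmul_assoc; reflexivity.
    - transitivity ((Cpow (Delta_plus q x) n * Cpow (/ Delta_plus q x) n) * Cpow x n)%C; [ring|].
      rewrite Cpow_inv_r by (apply Delta_plus_neq_0; assumption); ring. }
  assert (HR : exists R, MPp R /\ forall x, on_circle x -> Mldiff T x (Mscale x (R x))).
  { destruct HT as (H1 & H2 & H3 & H4), HTinv as (H5 & H6 & H7 & H8).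
    destruct (Pp_liouville_ldiff _ _ n H1 H5) as (r1 & P1 & L1);
      [intros x Hx; rewrite HTT by exact Hx; reflexivity|].
    destruct (Pp_liouville_ldiff _ _ n H2 H6) as (r2 & P2 & L2);
      [intros x Hx; rewrite HTT by exact Hx; reflexivity|].
    destruct (Pp_liouville_ldiff _ _ n H3 H7) as (r3 & P3 & L3);
      [intros x Hx; rewrite HTT by exact Hx; reflexivity|].
    destruct (Pp_liouville_ldiff _ _ n H4 H8) as (r4 & P4 & L4);
      [intros x Hx; rewrite HTT by exact Hx; reflexivity|].
    exists (fun x => mkM2 (r1 x) (r2 x) (r3 x) (r4 x)); split; [repeat split; assumption|].
    intros x Hx; repeat split; mred; auto. }
  destruct HR as (R & HR & HTR).
  pose (Q := half_q q).
  (* This is [Delta_plus^2 / x] times the derivative of [W = Delta_plus ^ (-n) T]. Both summands of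
     that derivative contain a factor [x], so the division leaves nonnegative frequencies. *)
  pose (e := fun x => Mscale (Cpow (/ Delta_plus q x) n)
    (Madd (Mscale (Delta_plus q x * Delta_plus q x) (R x))
          (Mscale (- (RtoC (INR n) * (Q * Q * x))) (T x)))).
  assert (He : MPp e).
  { apply MPp_scale; [apply Pp_pow, Pp_Delta_plus_inv, hq|].
    apply MPp_add; apply MPp_scale; try assumption.
    - apply Pp_mul; apply Pp_Delta_plus, hq.
    - apply Pp_opp; repeat apply Pp_mul; auto using Pp_const, Pp_id. }
  assert (HWe : forall x, on_circle x ->
    Mldiff W x (Mscale (/ (Delta_plus q x * Delta_plus q x) * x) (e x))).
  { intros x Hx; pose proof (Delta_plus_neq_0 q hq x Hx) as Hd.
    eapply Mldiff_ext; [exact Hx| | |].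
    3: { apply (Mldiff_scale (fun y => Cpow (/ Delta_plus q y) n)); [exact Hx| |apply HTR, Hx].
         apply ldiff_Delta_plus_inv_pow; assumption. }
    - intros y Hy; unfold T; cbv beta; rewrite Mscale_scale.
      replace (Cpow (/ Delta_plus q y) n * Cpow (Delta_plus q y) n)%C with 1%C; [mring|].
      rewrite <- (Cpow_inv_r (Delta_plus q y) n) by (apply Delta_plus_neq_0; assumption); ring.
    - unfold e, Q; cbv beta; generalize (T x) (R x); intros A B.
      apply M2_eq; mred; field; exact Hd. }
  (* The scalar in the derivative of [A_minus ^ m]. The sign from [x -> 1/x] and the sign from [- q]
     cancel. *)
  pose (kappa := fun x => (RtoC (INR m) *
    (Ci * Q * / x * / (Delta_plus q (/ x) * Delta_plus q (/ x))))%C).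
  pose (P := fun x => Mmul Dl (Mpow (A_plus (- q) (/ x)) m)).
  assert (HP : forall x, on_circle x -> Mldiff P x (Mscale (kappa x) (Mmul (P x) sigma1))).
  { intros x Hx; eapply Mldiff_ext; [exact Hx|reflexivity| |].
    2: { apply Mldiff_mul; [exact Hx|apply Mldiff_const|].
         apply (Mldiff_comp_inv (fun y => Mpow (A_plus (- q) y) m)); [exact Hx|].
         apply Mldiff_A_plus_pow; [exact hq'|apply circle_inv, Hx]. }
    unfold kappa, P, Q; cbv beta; rewrite Delta_plus_opp_q, half_q_opp.
    generalize (Mpow (A_plus (- q) (/ x)) m); mring. }
  assert (HdetP : forall x, on_circle x -> Mdet (P x) = 1%C).
  { intros x Hx; unfold P; rewrite Mdet_mul, HDl, Mdet_pow; [ring|].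
    apply Mdet_A_plus; [exact hq'|apply circle_inv, Hx]. }
  exists (fun x => Madd (Mmul (Mscale (kappa x) (Mmul (P x) sigma1)) (W x))
    (Mmul (P x) (Mscale (/ (Delta_plus q x * Delta_plus q x) * x) (e x)))).
  (* With [F = P W], the matrix [P] drops out: the logarithmic derivative is [kappa] times
     [W^-1 sigma1 W], plus [W^-1] times the derivative of [W]. Multiplying by
     [x Delta_plus^2 Delta_minus^2] clears [kappa], and [x^2 Delta_minus^2] becomes the polynomial
     [x^2 + Q^2]. *)
  exists (fun x => Madd
    (Mscale (RtoC (INR m) * (Ci * Q) * (Delta_plus q x * Delta_plus q x))
      (Mmul (Mmul (Madj (W x)) sigma1) (W x)))
    (Mscale (x * x + Q * Q) (Mmul (Madj (W x)) (e x)))).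
  split.
  - apply MPp_add; apply MPp_scale.
    + apply Pp_mul; [apply Pp_const|]; apply Pp_mul; apply Pp_Delta_plus, hq.
    + apply MPp_mul; [apply MPp_mul|]; auto using MPp_adj, MPp_const.
    + apply Pp_add; [apply Pp_mul; apply Pp_id|apply Pp_const].
    + apply MPp_mul; auto using MPp_adj.
  - intros x Hx; split.
    + apply (Mldiff_mul P W); auto.
    + fold (P x); rewrite Minv_det_1 by (rewrite Mdet_mul, HdetP, HdetW by exact Hx; ring).
      rewrite Madj_mul, Mmul_add_r, Mmul_scale_l, !Mmul_scale_r.
      rewrite !(Mmul_assoc (Madj (W x)) (Madj (P x))), <- !(Mmul_assoc (Madj (P x)) (P x)).
      rewrite (Mmul_assoc (P x)), <- (Mmul_assoc (Madj (P x)) (P x)), Madj_mul_l, !Mmul_1_l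
        by auto.
      pose proof (Delta_plus_neq_0 q hq x Hx) as Hd.
      pose proof (Delta_plus_neq_0 q hq (/ x)%C (circle_inv x Hx)) as Hd'.
      pose proof (circle_neq_0 x Hx) as Hx0.
      assert (E1 : (x * (Delta_plus q x * Delta_plus q x *
                    (Delta_plus q (/ x) * Delta_plus q (/ x))) * kappa x)%C =
                   (RtoC (INR m) * (Ci * Q) * (Delta_plus q x * Delta_plus q x))%C)
        by (unfold kappa; field; auto).
      assert (E2 : (x * (Delta_plus q x * Delta_plus q x *
                    (Delta_plus q (/ x) * Delta_plus q (/ x))) *
                    (/ (Delta_plus q x * Delta_plus q x) * x))%C = (x * x + Q * Q)%C).
      { transitivity (x * x * (Delta_plus q (/ x) * Delta_plus q (/ x)))%C;
          [field; auto|].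
        rewrite Delta_plus_sqr; fold Q; field; exact Hx0. }
      rewrite <- E1, <- E2, <- Mmul_assoc.
      generalize (Mmul (Mmul (Madj (W x)) sigma1) (W x)) (Mmul (Madj (W x)) (e x)); mring.
Qed.

(** * Symmetries *)

(** The shape with [RtoC (-1)] is an entry of the matrix in [circle_deriv] once [Msub] is
    unfolded. *)
Lemma ldiff_difference_quotient (f : Cplx -> Cplx) (x E : Cplx) : on_circle x -> ldiff f x E ->
  forall eps, 0 < eps -> exists delta, 0 < delta /\
    forall y, on_circle y -> y <> x -> Cnorm (y - x) < delta ->
      Cnorm (/ (y - x) * (f y + RtoC (-1) * f x) + RtoC (-1) * (/ x * E)) < eps.
Proof.
  intros Hx (phi & H1 & <- & H3) eps He; destruct (H1 eps He) as [d [Hd H]].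
  exists d; split; [exact Hd|]; intros y Hy Hyx Hn.
  assert (Hne : (y - x)%C <> 0%C).
  { intros H0; apply Hyx; replace y with ((y - x) + x)%C by ring; rewrite H0; ring. }
  replace (RtoC (-1)) with (- (1))%C by cplx.
  replace (f y + - (1) * f x)%C with (f y - f x)%C by ring; rewrite H3 by exact Hy.
  match goal with |- Cnorm ?e < _ => replace e with (/ x * (phi y - phi x))%C end.
  - rewrite Cnorm_mul, (circle_inv x Hx), Rmult_1_l; auto.
  - field; auto using circle_neq_0.
Qed.

Lemma Mldiff_circle_deriv (F : Cplx -> M2) (x : Cplx) (E : M2) :
  on_circle x -> Mldiff F x E -> circle_deriv F x (Mscale (/ x) E).
Proof.
  intros Hx (H1 & H2 & H3 & H4) eps He.
  destruct (ldiff_difference_quotient _ _ _ Hx H1 (eps / 4)) as (d1 & Hd1 & D1); [lra|].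
  destruct (ldiff_difference_quotient _ _ _ Hx H2 (eps / 4)) as (d2 & Hd2 & D2); [lra|].
  destruct (ldiff_difference_quotient _ _ _ Hx H3 (eps / 4)) as (d3 & Hd3 & D3); [lra|].
  destruct (ldiff_difference_quotient _ _ _ Hx H4 (eps / 4)) as (d4 & Hd4 & D4); [lra|].
  exists (Rmin (Rmin d1 d2) (Rmin d3 d4)); split; [repeat apply Rmin_pos; assumption|].
  intros y Hy Hyx Hn.
  apply Rmin_Rgt in Hn; destruct Hn as [Ha Hb].
  apply Rmin_Rgt in Ha; apply Rmin_Rgt in Hb; destruct Ha, Hb.
  specialize (D1 y Hy Hyx ltac:(assumption)); specialize (D2 y Hy Hyx ltac:(assumption)).
  specialize (D3 y Hy Hyx ltac:(assumption)); specialize (D4 y Hy Hyx ltac:(assumption)).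
  unfold Mnorm, Msub; mred; lra.
Qed.

(** Jacobi's formula: the trace of [Madj F] times the derivative of [F] is the derivative of the
    determinant, here constant. *)
Lemma trace_log_derivative (F : Cplx -> M2) (x : Cplx) (E : M2) :
  on_circle x -> (forall y, on_circle y -> Mdet (F y) = 1%C) -> Mldiff F x E ->
  (m11 (Mmul (Madj (F x)) E) + m22 (Mmul (Madj (F x)) E))%C = 0%C.
Proof.
  intros Hx Hdet (H1 & H2 & H3 & H4).
  assert (Hc : ldiff (fun y => m11 (F y) * m22 (F y) + - (1) * (m12 (F y) * m21 (F y)))%C x 0).
  { apply (ldiff_ext (fun _ => 1%C) _ _ 0%C); [exact Hx| |reflexivity|apply ldiff_const].
    intros y Hy; symmetry; etransitivity; [|exact (Hdet y Hy)]; unfold Mdet; ring. }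
  apply (ldiff_unique _ _ _ _ Hx) with (2 := Hc).
  eapply ldiff_ext; [exact Hx|reflexivity| |apply ldiff_add; [apply ldiff_mul; eassumption|
    apply ldiff_mul; [exact Hx|apply ldiff_const|apply ldiff_mul; eassumption]]].
  mred; ring.
Qed.

Lemma Cadd_half (z w : Cplx) : z = w -> z = (RtoC (/ 2) * (z + w))%C.
Proof. intros <-; apply Cplx_eq; simpl; field. Qed.

Lemma Mdet_diag_expi (t : R) : Mdet (Mdiag (Cexpi t) (Cexpi (- t))) = 1%C.
Proof. unfold Mdet; mred; rewrite <- (Cexpi_opp_r t); ring. Qed.

(** * Twisting and reality conditions *)

Definition Mtwist (A : M2) : M2 := mkM2 (m11 A) (- m12 A)%C (- m21 A)%C (m22 A).

Lemma sigma3_conj (A : M2) : Mmul (Mmul sigma3 A) (Minv sigma3) = Mtwist A.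
Proof.
  assert (H : Minv sigma3 = sigma3).
  { unfold Minv, sigma3; apply M2_eq; unfold Mdet; mred; cbv zeta;
      apply Cplx_eq; simpl; field. }
  rewrite H; unfold sigma3, Mtwist; replace (RtoC (-1)) with (- (1))%C by cplx; mring.
Qed.

Lemma Mtwist_mul (A B : M2) : Mtwist (Mmul A B) = Mmul (Mtwist A) (Mtwist B).
Proof. unfold Mtwist; mring. Qed.

Lemma Mtwist_A_plus_pow (q : R) (n : nat) (x : Cplx) :
  Mpow (A_plus q (- x)) n = Mtwist (Mpow (A_plus q x) n).
Proof.
  assert (H : A_plus q (- x) = Mtwist (A_plus q x)).
  { unfold A_plus, Mtwist; rewrite Delta_plus_opp; cbv zeta; mring. }
  induction n as [|n IH]; cbn [Mpow].
  - unfold Mtwist; mring.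
  - rewrite Mtwist_mul, IH, H; reflexivity.
Qed.

Lemma Mconjt_mul (A B : M2) : Mconjt (Mmul A B) = Mmul (Mconjt B) (Mconjt A).
Proof.
  unfold Mconjt; apply M2_eq; mred; rewrite Cconj_add, !Cconj_mul; ring.
Qed.

(** The reality condition for the explicit factor: [Delta_plus] has real coefficients, and
    conjugating [i] flips the off-diagonal sign, which is what the adjugate does to [A_plus]. *)
Lemma Mconjt_A_plus_pow (q : R) (n : nat) (x : Cplx) : Rabs (q / 2) < 1 -> on_circle x ->
  Mconjt (Mpow (A_plus q (Cconj x)) n) = Mpow (Madj (A_plus q x)) n.
Proof.
  intros hq Hx.
  assert (H : Mconjt (A_plus q (Cconj x)) = Madj (A_plus q x)).
  { unfold A_plus, Mconjt; rewrite Delta_plus_conj by assumption; cbv zeta; apply M2_eq; mred.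
    all: rewrite Cconj_mul, Cconj_inv, Cconj_conj, ?Cconj_1, ?Cconj_mul, ?Cconj_conj;
      try reflexivity.
    all: replace (Cconj Ci) with (- Ci)%C by cplx.
    all: replace (Cconj (half_q q)) with (half_q q) by cplx; ring. }
  induction n as [|n IH]; cbn [Mpow].
  - apply M2_eq; unfold Mconjt; mred; cplx.
  - rewrite Mconjt_mul, IH, H, <- Mpow_succ_r; reflexivity.
Qed.

Lemma Madj_pow (A : M2) (n : nat) : Madj (Mpow A n) = Mpow (Madj A) n.
Proof.
  induction n as [|n IH]; [cbn [Mpow]; mring|].
  rewrite Mpow_succ_r, Madj_mul, IH; reflexivity.
Qed.

Lemma Mconjt_diag_expi (t : R) :
  Mconjt (Mdiag (Cexpi t) (Cexpi (- t))) = Madj (Mdiag (Cexpi t) (Cexpi (- t))).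
Proof.
  unfold Mconjt; apply M2_eq; mred; apply Cplx_eq; simpl;
    rewrite ?cos_neg, ?sin_neg; ring.
Qed.

Lemma MPp_plus (g : Cplx -> M2) : LoopSU2_plus g -> MPp g.
Proof.
  intros [_ (c & (H1 & H2 & H3 & H4) & Hc)].
  repeat split; (eapply Pp_wiener_plus; [eassumption|]);
    intros k Hk; cbv beta; rewrite Hc by exact Hk; reflexivity.
Qed.

Lemma MPp_minus_star (g : Cplx -> M2) :
  LoopSU2_minus_star g -> MPp (fun x => g (/ x)%C).
Proof.
  intros [_ (c & (H1 & H2 & H3 & H4) & Hc & _)].
  repeat split; (eapply (Pp_wiener_minus (fun x => _ (g x))); [eassumption|]);
    intros k Hk; cbv beta; rewrite Hc by exact Hk; reflexivity.
Qed.

(* A function with frequencies [>= -1] and [<= 1], split according to its parity. *)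
Lemma Pp_liouville_parity (f g h : Cplx -> Cplx) :
  Pp f -> Pp g ->
  (forall x, on_circle x -> f x = x * h x)%C ->
  (forall x, on_circle x -> f x = Cpow x 2 * g (/ x))%C ->
  exists a b c : Cplx,
    ((forall x, on_circle x -> h (- x)%C = h x) -> forall x, on_circle x -> h x = a) /\
    ((forall x, on_circle x -> h (- x)%C = (- h x)%C) ->
      forall x, on_circle x -> h x = b * / x + c * x)%C.
Proof.
  intros Hf Hg Hh H; destruct (Pp_liouville f g 2 Hf Hg H) as [t Ht].
  (* Since [f = x h], the coefficient [t j] belongs to the frequency [j - 1] of [h]; the even part
     keeps [t 1], the odd part [t 0] and [t 2]. *)
  exists (t 1%nat), (t 0%nat), (t 2%nat).
  assert (Hx : forall x, on_circle x -> h x = (t 0%nat * / x + t 1%nat + t 2%nat * x)%C).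
  { intros x Hx; pose proof (circle_neq_0 x Hx) as Hx0.
    transitivity (/ x * f x)%C; [rewrite Hh by exact Hx; field; exact Hx0|].
    rewrite Ht by exact Hx; cbn [seq map peval]; field; exact Hx0. }
  split; intros Hs x Hx1; pose proof (circle_neq_0 x Hx1) as Hx0;
    pose proof (circle_neq_0 _ (circle_opp x Hx1)) as Hx0'.
  - rewrite (Cadd_half (h x) (h (- x)%C)) by (symmetry; auto).
    rewrite !Hx by auto using circle_opp.
    transitivity (RtoC (/ 2) * (1 + 1) * t 1%nat)%C; [field; auto|].
    replace (RtoC (/ 2) * (1 + 1))%C with 1%C by (apply Cplx_eq; simpl; field); ring.
  - rewrite (Cadd_half (h x) (- h (- x))%C) by (rewrite Hs by exact Hx1; ring).
    rewrite !Hx by auto using circle_opp.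
    transitivity (RtoC (/ 2) * (1 + 1) * (t 0%nat * / x + t 2%nat * x))%C; [field; auto|].
    replace (RtoC (/ 2) * (1 + 1))%C with 1%C by (apply Cplx_eq; simpl; field); ring.
Qed.

Theorem theorem3p1 (q s l : R) (n m : nat)
  (hq : 0 < Rabs (q / 2) < 1) (hsl : s <> l)
  (Vm Vp : Cplx -> M2)
  (hVm : LoopSU2_minus_star Vm) (hVp : LoopSU2_plus Vp)
  (hdec : forall lam : Cplx, on_circle lam ->
     Mmul (Minv (F_plus q s n lam)) (G_minus q l m lam) = Mmul (Vm lam) (Minv (Vp lam))) :
  let F := fun lam => Mmul (F_plus q s n lam) (Vm lam) in
  exists a b c : Cplx, Re a = 0 /\
    forall lam : Cplx, on_circle lam ->
      exists D : M2, circle_deriv F lam D /\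
        Mscale lam (Mmul (Minv (F lam)) D) =
        Mscale (Cinv (Cmul (Cmul (Delta_plus q lam) (Delta_plus q lam))
                           (Cmul (Delta_minus q lam) (Delta_minus q lam))))
          (mkM2 a
                (Cadd (Cmul b (Cinv lam)) (Cmul c lam))
                (Copp (Cadd (Cmul (Cconj b) (Cinv lam)) (Cmul (Cconj c) lam)))
                (Copp a)).
Proof.
  intros F; destruct hq as [_ hq1].
  assert (hq2 : Rabs (- q / 2) < 1).
  { replace (- q / 2) with (- (q / 2)) by field; rewrite Rabs_Ropp; exact hq1. }
  pose proof hVm as [[_ HVm] _]; pose proof hVp as [[_ HVp] _].
  set (Ds := Mdiag (Cexpi s) (Cexpi (- s))); set (Dl := Mdiag (Cexpi l) (Cexpi (- l))).
  assert (HDs : Mdet Ds = 1%C) by apply Mdet_diag_expi.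
  assert (HDl : Mdet Dl = 1%C) by apply Mdet_diag_expi.
  assert (HF : forall x, F x = Mmul (Mmul Ds (Mpow (A_plus q x) n)) (Vm x)) by reflexivity.
  assert (HdetA : forall x, on_circle x -> Mdet (Mmul Ds (Mpow (A_plus q x) n)) = 1%C).
  { intros x Hx; rewrite Mdet_mul, HDs, Mdet_pow by (apply Mdet_A_plus; assumption); ring. }
  assert (Hkey : forall x, on_circle x ->
    Mmul (Mmul Dl (Mpow (A_plus (- q) (/ x)) m)) (Vp x) = F x).
  { intros x Hx.
    pose proof (hdec x Hx) as H; destruct (HVp x Hx) as [Hd _].
    unfold G_minus, F_plus in H; rewrite A_minus_eq in H; fold Ds Dl in H.
    rewrite (Minv_det_1 (Mmul Ds _)), (Minv_det_1 (Vp x)) in H by auto.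
    rewrite HF.
    set (G := Mmul Dl _) in *; set (P := Mmul Ds _) in *.
    transitivity (Mmul P (Mmul (Mmul (Madj P) G) (Vp x))).
    - rewrite <- !Mmul_assoc, Madj_mul_r, Mmul_1_l by (apply HdetA, Hx); reflexivity.
    - rewrite H, (Mmul_assoc (Vm x)), Madj_mul_l, Mmul_1_r by exact Hd; reflexivity. }
  destruct (dressed_ldiff q Dl Ds m n (fun y => Vm (/ y)%C) Vp)
    as (E & H & HHp & HE); auto using MPp_plus, MPp_minus_star.
  { intros x Hx; apply HVp, Hx. }
  { intros x Hx; rewrite Hkey, Cinv_inv by auto using circle_neq_0; reflexivity. }
  (* The same lemma for the loop [y -> F (1/y)]: diagonal factors, exponents and [V_+], [V_-] trade
     places, and [q] changes sign. *)
  destruct (dressed_ldiff (- q) Ds Dl n m Vp (fun y => Vm (/ y)%C))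
    as (E' & H' & HHp' & HE'); auto using MPp_plus, MPp_minus_star.
  { intros x Hx; apply HVm, circle_inv, Hx. }
  { intros x Hx; rewrite Ropp_involutive, <- HF, <- Hkey, Cinv_inv
      by auto using circle_neq_0, circle_inv; reflexivity. }
  assert (HFE : forall x, on_circle x -> Mldiff F x (E x)).
  { intros x Hx; eapply Mldiff_ext; [exact Hx|exact Hkey|reflexivity|apply HE, Hx]. }
  assert (HEE' : forall x, on_circle x -> E x = Mscale (- (1)) (E' (/ x)%C)).
  { intros x Hx; apply (Mldiff_unique F x _ _ Hx (HFE x Hx)).
    eapply Mldiff_ext; [exact Hx| |reflexivity|
      apply Mldiff_comp_inv; [exact Hx|apply HE', circle_inv, Hx]].
    intros y Hy; cbv beta; rewrite Ropp_involutive, Cinv_inv by auto using circle_neq_0.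
    symmetry; apply HF. }
  assert (HdetF : forall x, on_circle x -> Mdet (F x) = 1%C).
  { intros x Hx; rewrite HF, Mdet_mul, HdetA by exact Hx.
    destruct (HVm x Hx) as [-> _]; ring. }
  pose (delta := fun x => (Delta_plus q x * Delta_plus q x *
                           (Delta_plus q (/ x) * Delta_plus q (/ x)))%C).
  assert (Hdelta : forall x, on_circle x -> delta x <> 0%C).
  { intros x Hx; unfold delta.
    apply Cmul_neq_0; apply Cmul_neq_0; apply Delta_plus_neq_0; auto using circle_inv. }
  pose (X := fun x => Mmul (Madj (F x)) (E x)).
  assert (HHX : forall x, on_circle x -> H x = Mscale x (Mscale (delta x) (X x))).
  { intros x Hx; destruct (HE x Hx) as [_ ->]; rewrite Hkey, Minv_det_1 by auto.
    rewrite Mscale_scale; reflexivity. }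
  (* The function [delta] is invariant under [x -> 1/x], while the logarithmic derivative changes
     sign. Comparing the prefactor [x] of [H] with the prefactor [1/x] of [H'] at [1/x] gives the
     power [2], that is, frequencies of [delta X] at most 1. *)
  assert (HHX' : forall x, on_circle x -> H x = Mscale (Cpow x 2) (Mscale (- (1)) (H' (/ x)%C))).
  { intros x Hx; rewrite HHX by exact Hx.
    destruct (HE' (/ x)%C (circle_inv x Hx)) as [_ ->].
    rewrite Ropp_involutive, !Delta_plus_opp_q, !Cinv_inv, <- HF, Minv_det_1
      by auto using circle_neq_0.
    unfold X; rewrite (HEE' x Hx); fold (delta x).
    replace (Delta_plus q (/ x) * Delta_plus q (/ x) * (Delta_plus q x * Delta_plus q x))%C
      with (delta x) by (unfold delta; ring).
    rewrite Mmul_scale_r; generalize (Mmul (Madj (F x)) (E' (/ x)%C)); intros B.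
    apply M2_eq; mred; cbn [Cpow]; field; apply circle_neq_0, Hx. }
  assert (Htrace : forall x, on_circle x -> (m11 (X x) + m22 (X x))%C = 0%C).
  { intros x Hx; apply trace_log_derivative; auto. }
  assert (Htwist : forall x, on_circle x -> X (- x)%C = Mtwist (X x)).
  { intros x Hx.
    assert (HFt : forall y, on_circle y -> F (- y)%C = Mtwist (F y)).
    { intros y Hy; destruct (HVm y Hy) as (_ & _ & Ht); rewrite sigma3_conj in Ht.
      rewrite !HF, <- Ht, Mtwist_A_plus_pow, !Mtwist_mul; f_equal; f_equal.
      unfold Mtwist, Ds; mring. }
    assert (HEt : E (- x)%C = Mtwist (E x)).
    { apply (Mldiff_unique (fun y => F (- y)%C) x _ _ Hx).
      - destruct (HFE (- x)%C (circle_opp x Hx)) as (H1 & H2 & H3 & H4).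
        repeat split; [apply (ldiff_comp_opp (fun y => m11 (F y)))
          |apply (ldiff_comp_opp (fun y => m12 (F y)))
          |apply (ldiff_comp_opp (fun y => m21 (F y)))
          |apply (ldiff_comp_opp (fun y => m22 (F y)))]; assumption.
      - apply (Mldiff_ext (fun y => Mtwist (F y)) _ _ (Mtwist (E x))); [exact Hx| |reflexivity|].
        { intros y Hy; symmetry; auto. }
        destruct (HFE x Hx) as (H1 & H2 & H3 & H4); unfold Mtwist; repeat split; mred.
        + exact H1.
        + eapply ldiff_ext; [exact Hx| | |apply (ldiff_mul (fun _ => (- (1))%C));
            [exact Hx|apply ldiff_const|exact H2]]; intros; cbv beta; ring.
        + eapply ldiff_ext; [exact Hx| | |apply (ldiff_mul (fun _ => (- (1))%C));
            [exact Hx|apply ldiff_const|exact H3]]; intros; cbv beta; ring.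
        + exact H4. }
    unfold X; rewrite HFt, HEt by exact Hx; unfold Mtwist; mring. }
  (* Both [F] and [E] equal the adjugate of their conjugate transpose at [Cconj x]; hence so does
     [X], by the product reversal of both operations. *)
  assert (Hreal : forall x, on_circle x ->
    m11 (X x) = Cconj (m22 (X (Cconj x))) /\ m12 (X x) = (- Cconj (m21 (X (Cconj x))))%C).
  { intros x Hx.
    assert (HFr : forall y, on_circle y -> F y = Madj (Mconjt (F (Cconj y)))).
    { intros y Hy; destruct (HVm y Hy) as (_ & Ht & _).
      rewrite Minv_det_1 in Ht.
      - rewrite !HF, Mconjt_mul, Mconjt_mul, Mconjt_A_plus_pow by assumption.
        rewrite Ht at 1; unfold Ds; rewrite Mconjt_diag_expi, <- Madj_pow.
        unfold Mconjt; mring.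
      - destruct (HVm (Cconj y) (circle_conj y Hy)) as (Hd & _).
        unfold Mdet, Mconjt in *; mred.
        apply (f_equal Cconj) in Hd; rewrite Cconj_1, Cconj_sub, !Cconj_mul in Hd.
        rewrite <- Hd; ring. }
    assert (HEr : E x = Madj (Mconjt (E (Cconj x)))).
    { apply (Mldiff_unique F x _ _ Hx (HFE x Hx)).
      destruct (HFE (Cconj x) (circle_conj x Hx)) as (H1 & H2 & H3 & H4).
      apply (Mldiff_ext (fun y => Madj (Mconjt (F (Cconj y)))) _ _
        (Madj (Mconjt (E (Cconj x))))); [exact Hx| |reflexivity|].
      { intros y Hy; symmetry; auto. }
      unfold Mconjt; repeat split; mred.
      - apply (ldiff_comp_conj (fun y => m22 (F y))); assumption.
      - eapply ldiff_ext; [exact Hx| | |apply (ldiff_mul (fun _ => (- (1))%C));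
          [exact Hx|apply ldiff_const|
           apply (ldiff_comp_conj (fun y => m21 (F y))); eassumption]];
          intros; cbv beta; ring.
      - eapply ldiff_ext; [exact Hx| | |apply (ldiff_mul (fun _ => (- (1))%C));
          [exact Hx|apply ldiff_const|
           apply (ldiff_comp_conj (fun y => m12 (F y))); eassumption]];
          intros; cbv beta; ring.
      - apply (ldiff_comp_conj (fun y => m11 (F y))); assumption. }
    unfold X; rewrite HEr, (HFr x Hx); unfold Mconjt; mred.
    rewrite !Cconj_add, !Cconj_mul, !Cconj_opp; split; ring. }
  assert (Hdelta_opp : forall x, on_circle x -> delta (- x)%C = delta x).
  { intros x Hx; unfold delta; replace (/ - x)%C with (- / x)%C.
    - rewrite !Delta_plus_opp; reflexivity.
    - field; split; apply circle_neq_0; [|exact Hx]; apply (circle_opp x Hx). }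
  assert (Hdelta_conj : forall x, on_circle x -> delta (Cconj x) = Cconj (delta x)).
  { intros x Hx; unfold delta; rewrite <- Cconj_inv, !Delta_plus_conj by auto using circle_inv.
    rewrite !Cconj_mul; reflexivity. }
  destruct HHp as (P11 & P12 & _), HHp' as (P11' & P12' & _).
  destruct (Pp_liouville_parity (fun x => m11 (H x)) (fun x => - (1) * m11 (H' x))%C
    (fun x => delta x * m11 (X x))%C) as (a & _ & _ & Ha & _).
  { exact P11. }
  { apply Pp_mul; [apply Pp_const|exact P11']. }
  { intros x Hx; rewrite HHX by exact Hx; reflexivity. }
  { intros x Hx; rewrite HHX' by exact Hx; reflexivity. }
  destruct (Pp_liouville_parity (fun x => m12 (H x)) (fun x => - (1) * m12 (H' x))%C
    (fun x => delta x * m12 (X x))%C) as (_ & b & c & _ & Hbc).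
  { exact P12. }
  { apply Pp_mul; [apply Pp_const|exact P12']. }
  { intros x Hx; rewrite HHX by exact Hx; reflexivity. }
  { intros x Hx; rewrite HHX' by exact Hx; reflexivity. }
  cbv beta in Ha, Hbc.
  specialize (Ha ltac:(intros x Hx; rewrite Hdelta_opp, Htwist by exact Hx; reflexivity)).
  specialize (Hbc ltac:(intros x Hx; rewrite Hdelta_opp, Htwist by exact Hx;
    cbn [Mtwist m12]; ring)).
  assert (H22 : forall x, on_circle x -> (delta x * m22 (X x))%C = (- a)%C).
  { intros x Hx; rewrite <- (Ha x Hx); transitivity
      (delta x * ((m11 (X x) + m22 (X x)) - m11 (X x)))%C; [ring|].
    rewrite Htrace by exact Hx; ring. }
  (* The formula for the upper right entry is conjugated at [Cconj x]: this conjugates [b] and [c]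
     but leaves the powers of [x] in place. *)
  assert (H21 : forall x, on_circle x ->
    (delta x * m21 (X x))%C = (- (Cconj b * / x + Cconj c * x))%C).
  { intros x Hx; pose proof (circle_conj x Hx) as Hx'.
    destruct (Hreal (Cconj x) Hx') as [_ Hr]; rewrite Cconj_conj in Hr.
    pose proof (Hbc (Cconj x) Hx') as H1; rewrite Hr, Hdelta_conj in H1 by exact Hx.
    apply (f_equal Cconj) in H1.
    rewrite Cconj_add, !Cconj_mul, Cconj_opp, Cconj_inv, !Cconj_conj in H1.
    rewrite <- H1; ring. }
  exists a, b, c; split.
  (* At the real point [x = 1] the reality condition compares the diagonal entries at the same point
     and yields [a = Cconj (- a)]. *)
  - pose proof (Ha 1%C circle_1) as H1; pose proof (H22 1%C circle_1) as H2.
    destruct (Hreal 1%C circle_1) as [Hr _]; pose proof (Hdelta_conj 1%C circle_1) as Hd.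
    rewrite Cconj_1 in Hr, Hd; rewrite Hr, Hd in H1.
    rewrite <- Cconj_mul, H2 in H1.
    apply (f_equal Re) in H1; simpl in H1; lra.
  - intros x Hx; exists (Mscale (/ x) (E x)); split; [apply Mldiff_circle_deriv; auto|].
    rewrite Minv_det_1, Mmul_scale_r, Mscale_scale by auto; fold (X x).
    change (Delta_minus q x) with (Delta_plus q (/ x)); fold (delta x).
    rewrite <- (Hbc x Hx), <- (H21 x Hx), <- (H22 x Hx), <- (Ha x Hx).
    pose proof (Hdelta x Hx); pose proof (circle_neq_0 x Hx).
    apply M2_eq; mred; field; auto.
Qed.
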